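(* Let $\lambda>0$, $0<\alpha<1$ and $\mu>0$. The Lévy density $\nu_{N_{\alpha,\mu}}$ of the tempered space-fractional Poisson process $N_{\alpha,\mu}$ with parameters $\lambda,\alpha,\mu$ is $$\nu_{N_{\alpha,\mu}}(x)=\sum_{n=1}^\infty\mu^{\alpha-n}\binom{\alpha}{n}\lambda^n\sum_{l=1}^n\binom{n}{l}(-1)^{l+1}\delta_l(x).$$
   Context: The tempered space-fractional Poisson process is $N_{\alpha,\mu}(t)=N(D_{\alpha,\mu}(t))$, where $N$ is a homogeneous Poisson process with intensity $\lambda$ and $D_{\alpha,\mu}$ is an independent tempered $\alpha$-stable subordinator, $\mathbb{E}[e^{-sD_{\alpha,\mu}(t)}]=e^{-t((s+\mu)^\alpha-\mu^\alpha)}$, $s>0$. Its characteristic function is $\mathbb{E}[e^{i\theta N_{\alpha,\mu}(t)}]=e^{-t((\mu+\lambda(1-e^{i\theta}))^\alpha-\mu^\alpha)}$. Here $\delta_l$ is the Dirac delta concentrated at $l$ (so the ''Lévy density'' denotes the Lévy measure written as a combination of Dirac deltas), $\binom{\alpha}{n}=\alpha(\alpha-1)\cdots(\alpha-n+1)/n!$, and the Lévy measure $\nu$ is the one in $\mathbb{E}[e^{i\theta N_{\alpha,\mu}(t)}]=\exp\left(t\int_{\mathbb{R}\setminus\{0\}}(e^{i\theta x}-1)\,\nu(dx)\right)$.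
   Formalization: For λ ≥ μ the series of Dirac masses diverges, so equality with the Lévy measure is stated on bounded Borel sets for λ < μ; for all λ, μ > 0 the series is shown to represent the Lévy measure, carried by {1,2,…}, against polynomials vanishing at 0. *)

(* Defs.v *)
From HB Require Import structures.
From mathcomp Require Import all_boot all_order all_algebra.
From mathcomp Require Import all_classical all_reals all_analysis.
From mathcomp Require Import complex.

Set Implicit Arguments.
Unset Strict Implicit.
Unset Printing Implicit Defensive.

Import Order.TTheory GRing.Theory Num.Theory.
Import numFieldNormedType.Exports.
Import ComplexField.

Local Open Scope classical_set_scope.
Local Open Scope complex_scope.
Local Open Scope ring_scope.

(* Complex-valued integrals over a measure, componentwise in R[i].            *)

Definition cexp (R : realType) (z : R[i]) : R[i] :=
  (expR (complex.Re z) * cos (complex.Im z))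
    +i* (expR (complex.Re z) * sin (complex.Im z)).

Definition cintegrable (d : measure_display) (T : measurableType d)
    (R : realType) (m : {measure set T -> \bar R}) (f : T -> R[i]) : Prop :=
  m.-integrable setT (fun x => (complex.Re (f x))%:E) /\
  m.-integrable setT (fun x => (complex.Im (f x))%:E).

Definition cintegral (d : measure_display) (T : measurableType d)
    (R : realType) (m : {measure set T -> \bar R}) (f : T -> R[i]) : R[i] :=
  Rintegral m setT (fun x => complex.Re (f x))
    +i* Rintegral m setT (fun x => complex.Im (f x)).

(* Stochastic processes are functions X : R -> T -> R of which only the times *)
(* t >= 0 matter.                                                             *)

(* Letting some of the B i be setT gives the product rule for subfamilies, so *)
(* this is mutual independence of the n increments.                           *)
Definition independent_increments (d : measure_display) (T : measurableType d)
    (R : realType) (P : probability T R) (X : R -> T -> R) : Prop :=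
  forall (n : nat) (t : nat -> R) (B : nat -> set R),
    0 <= t 0%N -> (forall i, t i <= t i.+1) -> (forall i, measurable (B i)) ->
    P (\bigcap_(i in [set i | (i < n)%N])
         [set w | B i (X (t i.+1) w - X (t i) w)]) =
    (\prod_(i < n) P [set w | B i (X (t i.+1) w - X (t i) w)%R])%E.

Definition stationary_increments (d : measure_display) (T : measurableType d)
    (R : realType) (P : probability T R) (X : R -> T -> R) : Prop :=
  forall (s t : R) (B : set R), 0 <= s -> 0 <= t -> measurable B ->
    P [set w | B (X (s + t) w - X s w)] = P [set w | B (X t w - X 0 w)].

Definition cadlag (R : realType) (x : R -> R) : Prop :=
  (forall t, 0 <= t -> x s @[s --> t^'+] --> x t) /\
  (forall t, 0 < t -> cvg (x s @[s --> t^'-])).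

Record levy_process (d : measure_display) (T : measurableType d)
    (R : realType) (P : probability T R) (X : R -> T -> R) : Prop := {
  levy_measurable : forall t, 0 <= t -> measurable_fun setT (X t);
  levy_start : forall w, X 0 w = 0;
  levy_independent : independent_increments P X;
  levy_stationary : stationary_increments P X;
  levy_stochastic_continuity : forall e : R, 0 < e ->
    P [set w | e < `|X t w|] @[t --> 0^'+] --> 0%E;
  levy_cadlag : forall w, cadlag (X ^~ w) }.

Record poisson_process (d : measure_display) (T : measurableType d)
    (R : realType) (P : probability T R) (lambda : R) (N : R -> T -> R)
    : Prop := {
  poisson_levy : levy_process P N;
  poisson_marginal : forall (t : R) (k : nat), 0 < t ->
    P [set w | N t w = k%:R] = (poisson_pmf (lambda * t) k)%:E }.

Record tempered_stable_subordinator (d : measure_display)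
    (T : measurableType d) (R : realType) (P : probability T R)
    (alpha mu : R) (D : R -> T -> R) : Prop := {
  tempered_levy : levy_process P D;
  tempered_nondecreasing : forall (w : T) (s t : R),
    0 <= s -> s <= t -> D s w <= D t w;
  tempered_laplace : forall s t : R, 0 < s -> 0 <= t ->
    ('E_P[fun w => expR (- s * D t w)%R] =
      (expR (- t * ((s + mu) `^ alpha - mu `^ alpha)))%:E)%E }.

(* The finite-dimensional cylinders form pi-systems generating the sigma-     *)
(* algebras of the two processes.                                             *)
Definition independent_processes (d : measure_display) (T : measurableType d)
    (R : realType) (P : probability T R) (X Y : R -> T -> R) : Prop :=
  forall (n m : nat) (s t : nat -> R) (A B : nat -> set R),
    (forall i, 0 <= s i) -> (forall i, 0 <= t i) ->
    (forall i, measurable (A i)) -> (forall i, measurable (B i)) ->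
    let EX := \bigcap_(i in [set i | (i < n)%N]) [set w | A i (X (s i) w)] in
    let EY := \bigcap_(i in [set i | (i < m)%N]) [set w | B i (Y (t i) w)] in
    (P (EX `&` EY) = P EX * P EY)%E.

Definition subordinated (R : realType) (T : Type) (N D : R -> T -> R)
    (t : R) (w : T) : R := N (D t w) w.

(* A measure on R \ {0} is encoded as a measure on R not charging {0}.        *)
Record levy_measure (d : measure_display) (T : measurableType d)
    (R : realType) (P : probability T R) (X : R -> T -> R)
    (nu : {measure set (measurableTypeR R) -> \bar R}) : Prop := {
  levy_measure_origin : nu [set 0] = 0%E;
  levy_measure_finite :
    (\int[nu]_x (Num.min 1 (x ^+ 2))%:E < +oo)%E;
  levy_measure_integrable : forall theta : R,
    cintegrable nu (fun x : R => cexp (0 +i* (theta * x)) - 1);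
  levy_measure_exponent : forall theta t : R, 0 <= t ->
    cintegral P (fun w => cexp (0 +i* (theta * X t w))) =
    cexp (t%:C * cintegral nu (fun x : R => cexp (0 +i* (theta * x)) - 1)) }.

Definition gbinom (R : realType) (a : R) (n : nat) : R :=
  (\prod_(i < n) (a - i%:R)) / n`!%:R.

(* The finite signed measure                                                  *)
(*   mu^(alpha-n) binom(alpha,n) lambda^n                                     *)
(*     sum_(1 <= l <= n) binom(n,l) (-1)^(l+1) delta_l                        *)
(* integrated against f, each delta_l acting by f |-> f l; its value on a set *)
(* A is obtained with f = \1_A. For fixed l the mass at l is of size          *)
(* n^(l-1-alpha) (lambda/mu)^n, so the series over n >= 1 has convergent      *)
(* masses only when lambda < mu (at lambda = mu, only the mass at 1 still     *)
(* converges). Against a polynomial f with f 0 = 0 the inner sum is, up to    *)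
(* sign, the n-th difference of f at 0, which vanishes for n > deg f: there   *)
(* the series makes sense for all lambda, mu > 0.                             *)
Definition levy_term (R : realType) (lambda alpha mu : R) (n : nat)
    (f : R -> R) : R :=
  mu `^ (alpha - n%:R) * gbinom alpha n * lambda ^+ n *
  \sum_(1 <= l < n.+1) 'C(n, l)%:R * (-1) ^+ l.+1 * f l%:R.

(* Main.v *)
Require Import Defs.
From mathcomp Require Import all_boot all_order all_algebra.
From mathcomp Require Import all_classical all_reals all_analysis.
From mathcomp Require Import measurable_realfun complex ring lra.
Import Order.TTheory GRing.Theory Num.Theory.
Import numFieldNormedType.Exports.
Import ComplexField.
Local Open Scope classical_set_scope.
Local Open Scope ring_scope.
Set Implicit Arguments.
Unset Strict Implicit.
Unset Printing Implicit Defensive.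


(** Write C(z) = (mu + lambda)^alpha - (mu + lambda - lambda z)^alpha and let
    c_l be the coefficient of z^l in its binomial expansion at z = 0.  As
    0 < alpha < 1, every c_l is nonnegative, and the radius of convergence is
    (mu + lambda) / lambda > 1.  The claim is that the Levy measure is
    nu = \sum_(l >= 1) c_l delta_l; the series of the theorem is the same
    function expanded in powers of lambda (1 - z) / mu instead of z.

    Conditioning the Poisson process on the independent time D_t gives
    P(N(D_t) = k) = p_k with
    \sum_k p_k z^k = E exp (- lambda (1 - z) D_t) = exp (t (C(z) - C(1)))
    for 0 <= z < 1.  Independence is only known for finitely many times, so D_t
    is first rounded up to a grid, where the path of N is evaluated at
    deterministic times, and right-continuity lets the mesh go to 0
    ([ptc_above_law], [ptc_law], [ptc_gen]).

    The characteristic function needs this identity on |z| = 1, where the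
    Laplace transform of D_t gives no direct information.  Both sides are power
    series in z.  The derivative of the identity on (0, 1) is a recursion on
    the p_k, and on each ray z = r e^(i theta) this recursion is a linear
    differential equation in r solved by exp (t (C(z) - C(1))); Abel summation
    then reaches r = 1 ([exp_pseries_rec], [linear_ode2],
    [compound_poisson_cf]).  This yields existence
    ([levy_measure_of_masses]).

    For uniqueness, the exponent at theta = 2 pi is the integral of
    cos (2 pi x) - 1, which vanishes for the measure above; any other Levy
    measure of the process is therefore carried by the integers, hence finite,
    and its atoms are recovered from the exponent by averaging over roots of
    unity ([carried_by_int], [lattice_atom_cvg], [levy_measure_nat_unique]).

    Finally both readings of the series rest on one identity, the binomial
    series differentiated j times ([binomial_series_bin]).  At
    - lambda / (mu + lambda) it computes the factorial moments
    \sum_l c_l C(l, j), and the n-th term of the density paired with C(x, j)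
    vanishes unless n = j, whence the statement for polynomials.  At
    lambda / mu < 1 it sums the contributions of all n to a single atom. *)

(** * Limits and series *)

Lemma derive0_cst (R : realType) (f : R -> R) (a b x y : R) :
  x \in `]a, b[ -> y \in `]a, b[ ->
  (forall z, z \in `]a, b[ -> is_derive z (1 : R) f 0) -> f x = f y.
Proof.
wlog xy : x y / x <= y.
  move=> h xab yab f0; case: (leP x y) => [/h|/ltW /h]; first exact.
  by move=> h'; symmetry; exact: h'.
rewrite !in_itv/= => /andP[ax xb] /andP[ay yb] f0.
have sub z : z \in `[x, y] -> z \in `]a, b[.
  by rewrite !in_itv/= => /andP[xz zy]; rewrite (lt_le_trans ax)//= (le_lt_trans zy).
have f0xy z : z \in `]x, y[ -> is_derive z (1 : R) f ((fun=> 0) z).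
  by rewrite in_itv/= => /andP[xz zy]; apply: f0; apply: sub; rewrite in_itv/= !ltW.
have cf : {within `[x, y], continuous f}.
  by apply: derivable_within_continuous => z /sub /f0 [].
have [z _ /eqP] := MVT_segment xy f0xy cf.
by rewrite mul0r subr_eq0 => /eqP.
Qed.

Lemma cvgn_ext (R : realType) (u v : nat -> R) (l : R) :
  u =1 v -> u @ \oo --> l -> v @ \oo --> l.
Proof. by move=> /funext ->. Qed.

Lemma cvgn_scale (R : realType) (c : R) (u : nat -> R) (l : R) :
  u @ \oo --> l -> (fun n => c * u n) @ \oo --> c * l.
Proof. exact: cvgMl_tmp. Qed.
Arguments cvgn_scale {R} c {u l}.

Lemma cvgn_comp (R : realType) (f : R -> R) (u : nat -> R) (l : R) :
  continuous f -> u @ \oo --> l -> (fun n => f (u n)) @ \oo --> f l.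
Proof. by move=> cf; apply: continuous_cvg; exact: cf. Qed.
Arguments cvgn_comp {R} f {u l}.

Lemma cvg_series_scale (R : realType) (c : R) (u : nat -> R) (l : R) :
  series u @ \oo --> l -> series (fun n => c * u n) @ \oo --> c * l.
Proof.
move=> ul; apply: (cvgn_ext _ (cvgn_scale c ul)) => n.
by rewrite /series/= mulr_sumr.
Qed.
Arguments cvg_series_scale {R} c {u l}.

Lemma cvg_series_shift (R : realType) (u : nat -> R) (j : nat) (s : R) :
  (forall n, (n < j)%N -> u n = 0) ->
  series (fun n => u (n + j)%N) @ \oo --> s -> series u @ \oo --> s.
Proof.
move=> u0 us; rewrite -(cvg_shiftn j).
apply: cvg_trans us; apply: near_eq_cvg; apply: nearW => n /=.
rewrite /series/= [RHS](big_cat_nat (n := j)) ?leq_addl//=.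
rewrite [X in _ = X + _]big1_seq ?add0r.
  by rewrite -{2}(add0n j) big_addn addnK.
by move=> i /andP[_]; rewrite mem_index_iota => /andP[_ /u0].
Qed.

Lemma series_cvg_norm (R : realType) (u : nat -> R) :
  cvgn (series (fun n => `|u n|)) -> cvgn (series u).
Proof. by move=> h; exact: (@normed_cvg R R^o u). Qed.

Lemma series_tail_le (R : realType) (f b : nat -> R) (s e : R) (N : nat) :
  (forall k, `|f k| <= b k) -> cvgn (series b) ->
  limn (series b) - series b N <= e -> series f @ \oo --> s ->
  `|s - series f N| <= e.
Proof.
move=> fb cb be fs.
have : (fun n => `|series f n - series f N|) @ \oo --> `|s - series f N|.
  by apply: cvg_norm; apply: cvgB => //; exact: cvg_cst.
move/cvgr_to_le; apply; near=> n.
have Nn : (N <= n)%N by near: n; exact: nbhs_infty_ge.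
rewrite sub_series_geq//; apply: le_trans (ler_norm_sum _ _ _) _.
apply: le_trans (ler_sum _ (fun k _ => fb k)) _.
rewrite -sub_series_geq//; apply: le_trans be; rewrite lerD2r.
apply: nondecreasing_cvgn_le => //; apply: nondecreasing_series => k _ _.
exact: le_trans (fb k).
Unshelve. all: end_near. Qed.

(** Tannery's theorem, that is, dominated convergence for the counting measure. *)
Lemma cvg_series_dominated (R : realType) (f : nat -> nat -> R)
    (g b : nat -> R) (s : R) :
  (forall m k, `|f m k| <= b k) -> cvgn (series b) ->
  (forall k, f ^~ k @ \oo --> g k) -> series g @ \oo --> s ->
  (fun m => limn (series (f m))) @ \oo --> s.
Proof.
move=> fb cb fg gs.
have gb k : `|g k| <= b k.
  have h : (fun m => `|f m k|) @ \oo --> `|g k| by apply: cvg_norm; exact: fg.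
  by apply: (cvgr_to_le h); apply: nearW => m; exact: fb.
have cf m : cvgn (series (f m)).
  apply: series_cvg_norm; apply: series_le_cvg cb => // k.
  exact: le_trans (fb m k).
apply/cvgrPdist_le => e e0.
have e3 : 0 < e / 3 by rewrite divr_gt0.
have [N _ bN] : \forall N \near \oo, limn (series b) - series b N <= e / 3.
  move/cvgrPdist_le : (cb) => /(_ _ e3); apply: filterS => N.
  exact/le_trans/ler_norm.
have {}bN := bN N (leqnn N).
have : (fun m => series (f m) N) @ \oo --> series g N.
  rewrite /series/=; elim: N {bN} => [|N ih].
    by under eq_fun do rewrite big_nil; rewrite big_nil; exact: cvg_cst.
  under eq_fun do rewrite big_nat_recr//=; rewrite big_nat_recr//=.
  exact: cvgD.
move/cvgrPdist_le => /(_ _ e3); apply: filterS => m fgN.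
have t1 := series_tail_le gb cb bN gs.
have t2 := series_tail_le (fb m) cb bN (cf m).
rewrite (_ : s - _ = (s - series g N) + (series g N - series (f m) N)
  - (limn (series (f m)) - series (f m) N)); last by ring.
apply: le_trans (ler_normB _ _) _; apply: le_trans (lerD (ler_normD _ _) t2) _.
have := lerD t1 fgN; lra.
Qed.

(** * The binomial series *)

Lemma gbinom0 (R : realType) (b : R) : gbinom b 0 = 1.
Proof. by rewrite /gbinom big_ord0 fact0 divr1. Qed.

Lemma gbinomS (R : realType) (b : R) n :
  gbinom b n.+1 = gbinom b n * (b - n%:R) / n.+1%:R.
Proof.
rewrite /gbinom big_ord_recr/= factS natrM invfM.
by ring.
Qed.

Lemma gbinom_mulS (R : realType) (b : R) n :
  n.+1%:R * gbinom b n.+1 = b * gbinom (b - 1) n.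
Proof.
elim: n => [|n ih]; first by rewrite gbinomS !gbinom0; field.
rewrite gbinomS [gbinom (b - 1) _]gbinomS.
rewrite [LHS](_ : _ = n.+1%:R * gbinom b n.+1 * ((b - n.+1%:R) / n.+1%:R)).
  by rewrite ih -natr1; field; rewrite natr1.
by field; rewrite -natrD nat1r !pnatr_eq0.
Qed.

Lemma gbinom_pascal (R : realType) (b : R) n :
  gbinom b n.+1 = gbinom (b - 1) n.+1 + gbinom (b - 1) n.
Proof.
apply: (@mulfI _ n.+1%:R); first by rewrite pnatr_eq0.
rewrite gbinom_mulS mulrDr gbinomS -[n.+1%:R in RHS]natr1; field.
by rewrite natr1 pnatr_eq0.
Qed.

(** The ratio of consecutive terms tends to r < 1, so the terms decrease from
    some index on. *)
Lemma gbinom_bounded (R : realType) (b r : R) : 0 < r < 1 ->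
  exists K, forall n, `|gbinom b n| * r ^+ n <= K.
Proof.
move=> /andP[r0 r1].
pose u n := `|gbinom b n| * r ^+ n.
have u0 n : 0 <= u n by rewrite mulr_ge0// exprn_ge0// ltW.
(* (|b| + n) r <= n + 1 as soon as n >= (|b| + r) / (1 - r) *)
pose N := (Num.truncn ((`|b| + r) / (1 - r))).+1.
have decr n : (N <= n)%N -> u n.+1 <= u n.
  move=> Nn; rewrite /u gbinomS exprSr.
  move: (gbinom b n) => c; rewrite !normrM -!mulrA ler_wpM2l//.
  rewrite normfV [`|n.+1%:R|]ger0_norm// [r ^+ n * r]mulrC !mulrA.
  rewrite -[leRHS]mul1r ler_wpM2r ?exprn_ge0 ?(ltW r0)//.
  rewrite mulrAC ler_pdivrMr ?ltr0n// mul1r.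
  have : (`|b| + r) / (1 - r) < n%:R.
    by apply: lt_le_trans (truncnS_gt _) _; rewrite ler_nat.
  rewrite ltr_pdivrMr ?subr_gt0// => bn.
  apply: le_trans (_ : (`|b| + n%:R) * r <= _).
    rewrite ler_wpM2r ?(ltW r0)//.
    by apply: le_trans (ler_normB _ _) _; rewrite [`|n%:R|]ger0_norm.
  rewrite -natr1 mulrDl.
  have : `|b| * r <= `|b| by rewrite ler_piMr// ltW.
  by have := ltW r0; nra.
exists (\sum_(i < N.+1) u i) => n; rewrite -/(u n).
have [nN|/ltnW Nn] := leqP n N.
  rewrite (bigD1 (Ordinal (n:=N.+1) (m:=n) nN))//= lerDl; exact: sumr_ge0.
rewrite -(subnK Nn); elim: (n - N)%N => [|k ih].
  by rewrite add0n big_ord_recr/= lerDr; exact: sumr_ge0.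
by rewrite addSn; apply: le_trans ih; apply: decr; rewrite leq_addl.
Qed.

Lemma is_cvg_gbinom_series (R : realType) (b x : R) : `|x| < 1 ->
  cvgn (series (fun n => `|gbinom b n * x ^+ n|)).
Proof.
move=> x1.
have [r /andP[xr r1]] : exists r, `|x| < r < 1 by exists ((`|x| + 1) / 2); apply/andP; split; lra.
have r0 : 0 < r by exact: le_lt_trans xr.
have [K Kb] := @gbinom_bounded R b r (introT andP (conj r0 r1)).
apply: (@series_le_cvg _ _ (geometric K (`|x| / r))) => //.
- by move=> n; rewrite mulr_ge0// ?exprn_ge0// ?divr_ge0 ?(ltW r0)//;
    apply: le_trans (Kb 0%N); rewrite mulr_ge0// exprn_ge0// ltW.
- move=> n; rewrite /= normrM normrX expr_div_n mulrA ler_pdivlMr ?exprn_gt0//.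
  by rewrite mulrAC ler_wpM2r// exprn_ge0.
- apply: is_cvg_geometric_series.
  by rewrite ger0_norm ?divr_ge0 ?(ltW r0)// ltr_pdivrMr// mul1r.
Qed.

Lemma gbinom_diffs (R : realType) (b : R) :
  pseries_diffs (gbinom b) = (fun n => b * gbinom (b - 1) n).
Proof. by apply/funext => n; rewrite /pseries_diffs gbinom_mulS. Qed.
(** Pascal's rule, in the form (1 + x) f_(b-1)(x) = f_b(x) for partial sums; with
    f_b' = b f_(b-1) it is the differential equation of (1 + x)^b. *)
Lemma gbinom_series_pascal (R : realType) (b x : R) n :
  pseries (gbinom b) x n.+1 =
  pseries (gbinom (b - 1)) x n.+1 + x * pseries (gbinom (b - 1)) x n.
Proof.
rewrite /pseries/series/=; elim: n => [|n ih].
  by rewrite !big_nat1 big_nil !gbinom0; ring.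
rewrite big_nat_recr//= ih [X in _ = X + _]big_nat_recr//= [X in _ = _ + x * X]big_nat_recr//=.
by rewrite gbinom_pascal exprS; ring.
Qed.

Lemma cvg_gbinom_series (R : realType) (b x : R) : `|x| < 1 ->
  cvgn (pseries (gbinom b) x).
Proof. by move=> x1; apply: series_cvg_norm; exact: is_cvg_gbinom_series. Qed.

Lemma is_derive_gbinom_series (R : realType) (b x : R) : `|x| < 1 ->
  is_derive x (1 : R) (fun y => limn (pseries (gbinom b) y))
    (b * limn (pseries (gbinom (b - 1)) x)).
Proof.
move=> x1; pose K := (`|x| + 1) / 2.
have K0 : 0 <= K by rewrite /K; have := normr_ge0 x; lra.
have K1 : `|K| < 1 by rewrite ger0_norm// /K; lra.
have xK : `|x| < `|K| by rewrite [`|K|]ger0_norm// /K; lra.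
have scal (a d y : R) : pseries (fun n => a * gbinom d n) y = a *: pseries (gbinom d) y.
  rewrite /pseries -seriesZ; congr series; apply/funext => n /=.
  by rewrite -mulrA.
have h := @pseries_snd_diffs R (gbinom b) K x (cvg_gbinom_series K1).
rewrite gbinom_diffs !scal in h.
have -> : b * limn (pseries (gbinom (b - 1)) x) = limn (b *: pseries (gbinom (b - 1)) x).
  by rewrite limZl_tmp//; exact: cvg_gbinom_series.
apply: h => //; first by apply: is_cvgZl_tmp; exact: cvg_gbinom_series.
rewrite (_ : pseries_diffs _ = fun n => (b * (b - 1)) * gbinom (b - 1 - 1) n).
  by rewrite scal; apply: is_cvgZl_tmp; exact: cvg_gbinom_series.
by apply/funext => n; rewrite /pseries_diffs mulrCA gbinom_mulS mulrA.
Qed.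

(** The product of the series with (1 + x)^(- b) has derivative 0 on ]-1, 1[. *)
Lemma binomial_series (R : realType) (b x : R) : `|x| < 1 ->
  pseries (gbinom b) x @ \oo --> (1 + x) `^ b.
Proof.
move=> x1.
pose f (a y : R) := limn (pseries (gbinom a) y).
pose g (y : R) := expR (- b * ln (1 + y)).
have y1 (y : R) : y \in `](-1), 1[ -> `|y| < 1.
  by rewrite in_itv/= => /andP[? ?]; rewrite ltr_norml; apply/andP.
have y0 (y : R) : y \in `](-1), 1[ -> 0 < 1 + y.
  by rewrite in_itv/= => /andP[? ?]; lra.
have fE (y : R) : `|y| < 1 -> f b y = (1 + y) * f (b - 1) y.
  move=> y1'; apply/cvg_lim => //; rewrite -cvg_shiftS/=.
  under eq_fun do rewrite gbinom_series_pascal.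
  rewrite mulrDl mul1r; apply: cvgD.
    by rewrite cvg_shiftS; exact: cvg_gbinom_series.
  by apply: cvgM; [exact: cvg_cst|exact: cvg_gbinom_series].
have dg (y : R) : y \in `](-1), 1[ -> is_derive y (1 : R) g (g y * (- b / (1 + y))).
  move=> yi.
  have d1 : is_derive y (1 : R) (fun z : R => 1 + z) 1.
    by have := is_deriveD (is_derive_cst (1 : R) y (1 : R)) (is_derive_id y (1 : R)); rewrite add0r.
  have d2 := @is_derive1_comp _ (@ln R) _ _ _ _ (is_derive1_ln (y0 _ yi)) d1.
  have d3 := is_deriveZ (- b) d2.
  have d4 := @is_derive1_comp _ (@expR R) _ _ _ _ (is_derive_expR _) d3.
  apply: (is_derive_eq d4) => //.
  by rewrite /g/= /GRing.scale/= mulr1.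
have h0 (y : R) : y \in `](-1), 1[ -> is_derive y (1 : R) (f b * g) 0.
  move=> yi; have df := @is_derive_gbinom_series R b y (y1 _ yi).
  apply: is_derive_eq; first exact: (is_deriveM df (dg _ yi)).
  rewrite /GRing.scale/= -/(f b y) -/(f (b - 1) y) (fE _ (y1 _ yi)).
  by field; rewrite gt_eqF// y0.
have xi : x \in `](-1), 1[ by move: x1; rewrite ltr_norml in_itv.
have zi : (0 : R) \in `](-1), 1[ by rewrite in_itv/=; apply/andP; split; lra.
have : (f b * g) x = (f b * g) 0 := derive0_cst xi zi h0.
rewrite /GRing.mul/= /g addr0 ln1 mulr0 expR0 mulr1.
have -> : f b 0 = 1.
  apply/cvg_lim => //; rewrite -cvg_shiftS.
  apply: cvg_near_cst; apply: nearW => n.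
  rewrite /pseries/series/= big_nat_recl//= gbinom0 expr0 mulr1 big1 ?addr0// => i _.
  by rewrite exprS mul0r mulr0.
move=> fx; suff -> : (1 + x) `^ b = f b x by exact: cvg_gbinom_series.
rewrite /powR gt_eqF ?y0//.
apply: (mulIf (lt0r_neq0 (expR_gt0 (- b * ln (1 + x))))).
by rewrite fx mulNr expRxMexpNx_1.
Qed.

Lemma gbinom_bin (R : realType) (b : R) j n :
  'C(n + j, j)%:R * gbinom b (n + j) = gbinom b j * gbinom (b - j%:R) n.
Proof.
elim: n => [|n ih]; first by rewrite add0n binn gbinom0 mul1r mulr1.
rewrite addSn !gbinomS [RHS]mulrA [X in _ = X / _]mulrA -ih.
have e : 'C((n + j).+1, j)%:R * n.+1%:R = (n + j).+1%:R * 'C(n + j, j)%:R :> R.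
  rewrite -!natrM; congr (_%:R).
  by rewrite mulnC [RHS](mul_bin_down (n + j).+1) subSn ?leq_addl// addnK.
move: e; rewrite [(n + j)%:R]natrD; move: ('C(_, _))%:R ('C(_, _))%:R => B A e.
have -> : A = (n + j).+1%:R * B / n.+1%:R :> R by rewrite -e mulfK// pnatr_eq0.
move: (gbinom b (n + j)) => g.
by field; rewrite !nat1r -natrD ?nat1r !pnatr_eq0.
Qed.

(** This is the binomial series differentiated j times.  No derivative is taken:
    the terms of index n >= j are those of the series of exponent b - j, up to
    the factor gbinom b j x^j. *)
Lemma binomial_series_bin (R : realType) (b x : R) j : `|x| < 1 ->
  series (fun n => 'C(n, j)%:R * (gbinom b n * x ^+ n)) @ \oo
    --> gbinom b j * x ^+ j * (1 + x) `^ (b - j%:R).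
Proof.
move=> x1; apply: (@cvg_series_shift _ _ j) => [n nj|].
  by rewrite bin_small// mul0r.
have h := @binomial_series _ (b - j%:R) _ x1.
apply: (cvgn_ext _ (cvgn_scale (gbinom b j * x ^+ j) h)) => n /=.
rewrite /pseries/series/= mulr_sumr; apply: eq_bigr => i _.
by rewrite [RHS]mulrA gbinom_bin exprD; ring.
Qed.

(** * Uniqueness and products of power series *)

Lemma pseries_shiftE (R : realType) (a : nat -> R) (z : R) n :
  pseries a z n.+1 = a 0%N + z * pseries (fun k => a k.+1) z n.
Proof.
rewrite /pseries/series/= big_nat_recl//= expr0 mulr1 mulr_sumr; congr (_ + _).
by apply: eq_bigr => i _; rewrite exprS; ring.
Qed.


(** For small z the tail of the series is at most z M, so that |a_0| <= z M. *)
Lemma pseries_eq0_head (R : realType) (a : nat -> R) :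
  (forall z, 0 < z < 1 -> pseries a z @ \oo --> (0 : R)) -> a 0%N = 0.
Proof.
move=> a0; pose b k := a k.+1.
have bz z : 0 < z < 1 -> pseries b z @ \oo --> - a 0%N / z.
  move=> z01; have z0 : z != 0 by case/andP: z01 => z0 _; rewrite gt_eqF.
  have := a0 z z01; rewrite -cvg_shiftS => h.
  have h2 : (fun n => pseries a z n.+1 - a 0%N) @ \oo --> 0 - a 0%N.
    by apply: cvgB => //; exact: cvg_cst.
  rewrite sub0r in h2; rewrite mulrC.
  apply: (cvgn_ext _ (cvgn_scale z^-1 h2)) => k /=.
  by rewrite pseries_shiftE addrC addKr mulKf.
pose q : R := 4^-1.
have q0 : 0 < q by rewrite invr_gt0.
have q1 : q < 2^-1 by rewrite ltf_pV2 ?posrE// ltr_nat.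
have q2 : 0 < (2^-1 : R) < 1 by rewrite invr_gt0 ltr0n/= invf_lt1// ltr1n.
have Mc : cvgn (pseries (fun k => `|b k|) q).
  apply: (@is_cvg_pseries_inside_norm _ _ 2^-1); first by apply/cvg_ex; eexists; exact: bz.
  by rewrite !gtr0_norm//; case/andP: q2.
pose M := limn (pseries (fun k => `|b k|) q).
have bM z : 0 < z <= q -> `|a 0%N| <= z * M.
  move=> /andP[z0 zq].
  have z1 : z < 1 by rewrite (le_lt_trans zq)// (lt_trans q1)//; case/andP: q2.
  rewrite mulrC -ler_pdivrMr// -[X in _ / X]gtr0_norm// -normfV -normrM -normrN -mulNr.
  have : (fun n => `|pseries b z n|) @ \oo --> `|- a 0%N / z|.
    by apply: cvg_norm; apply: bz; rewrite z0.
  move/cvgr_to_le; apply; apply: nearW => n.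
  apply: le_trans (ler_norm_sum _ _ _) _.
  apply: (@le_trans _ _ (pseries (fun k => `|b k|) q n)).
    apply: ler_sum => i _; rewrite normrM ler_wpM2l// normrX lerXn2r ?nnegrE//.
      exact: ltW.
    by rewrite gtr0_norm.
  apply: nondecreasing_cvgn_le => //; apply: nondecreasing_series => k _ _.
  by rewrite mulr_ge0// exprn_ge0// ltW.
have M0 : 0 <= M.
  apply: le_trans (nondecreasing_cvgn_le _ Mc 0%N); first by rewrite /pseries/series/= big_nil.
  apply: nondecreasing_series => k _ _.
  by rewrite mulr_ge0// exprn_ge0// ltW.
apply/eqP; rewrite -normr_eq0; apply/negPn/negP => a00.
have n0 : 0 < `|a 0%N| by rewrite lt_neqAle eq_sym a00 normr_ge0.
set x := `|a 0%N| in bM n0.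
have d0 : 0 < x + M + 1 by lra.
(* the factor x / (x + M + 1) makes z M smaller than x = |a_0| *)
have := bM (q * (x / (x + M + 1))).
have h1 : 0 < x / (x + M + 1) by rewrite divr_gt0.
have h2 : x / (x + M + 1) <= 1 by rewrite ler_pdivrMr// mul1r; lra.
rewrite mulr_gt0//= ger_pMr// h2 => /(_ isT).
rewrite leNgt => /negP; apply.
have h3 : M / (x + M + 1) <= 1 by rewrite ler_pdivrMr// mul1r; lra.
rewrite (_ : _ * M = q * x * (M / (x + M + 1))); last by ring.
apply: (@le_lt_trans _ _ (q * x)); first by rewrite ler_piMr// mulr_ge0// ltW.
by rewrite gtr_pMl//; case/andP: q2; lra.
Qed.

Lemma pseries_eq0 (R : realType) (a : nat -> R) :
  (forall z, 0 < z < 1 -> pseries a z @ \oo --> (0 : R)) -> forall n, a n = 0.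
Proof.
move=> a0 n; elim: n a a0 => [|n ih] a a0; first exact: pseries_eq0_head.
apply: (ih (fun k => a k.+1)) => z z01.
have z0 : z != 0 by case/andP: z01 => z0 _; rewrite gt_eqF.
have := a0 z z01; rewrite -cvg_shiftS => h.
rewrite -(mulr0 z^-1).
apply: (cvgn_ext _ (cvgn_scale z^-1 h)) => k /=.
by rewrite pseries_shiftE (pseries_eq0_head a0) add0r mulKf.
Qed.

Definition cauchy_product (R : realType) (a b : nat -> R) (n : nat) : R :=
  \sum_(i < n.+1) a i * b (n - i)%N.

Lemma series_convE (R : realType) (a b : nat -> R) n :
  series (cauchy_product a b) n = \sum_(0 <= i < n) a i * series b (n - i)%N.
Proof.
elim: n => [|n ih]; first by rewrite /series/= !big_nil.
rewrite seriesSr ih /cauchy_product big_mkord [in RHS]big_mkord !big_ord_recr/= addrA.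
rewrite -big_split/= subSn ?leqnn// subnn; congr (_ + _).
  by apply: eq_bigr => i _; rewrite subSn ?(ltnW (ltn_ord i))// seriesSr mulrDr.
by rewrite /series/= big_nat1.
Qed.

(** Mertens' theorem: the partial sums of the product are
    \sum_(i < n) a_i B_(n - i), to which Tannery's theorem applies because the
    partial sums B of b are bounded. *)
Lemma cvg_series_conv (R : realType) (a b : nat -> R) (s t : R) :
  cvgn (series (fun n => `|a n|)) ->
  series a @ \oo --> s -> series b @ \oo --> t ->
  series (cauchy_product a b) @ \oo --> s * t.
Proof.
move=> ca as_ bt.
have [M [_ Mb]] : bounded_fun (series b).
  by apply: cvg_seq_bounded; apply/cvg_ex; exists t.
have {}Mb n : `|series b n| <= `|M| + 1.
  by apply: Mb => //; rewrite (le_lt_trans (ler_norm M))// ltrDl.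
pose f n i := if (i < n)%N then a i * series b (n - i)%N else 0.
have fE n : limn (series (f n)) = series (cauchy_product a b) n.
  apply/cvg_lim => //; rewrite series_convE -(cvg_shiftn n).
  apply: cvg_near_cst; apply: nearW => m.
  rewrite /series/= (big_cat_nat (n := n)) ?leq_addl//=.
  rewrite [X in _ + X]big1_seq ?addr0.
    by apply: eq_big_nat => i /andP[_ ni]; rewrite /f ni.
  by move=> i; rewrite mem_index_iota /f => /andP[_ /andP[ni _]]; rewrite ltnNge ni.
apply: (cvgn_ext fE).
apply: (@cvg_series_dominated _ f (fun i => a i * t) (fun i => (`|M| + 1) * `|a i|)).
- move=> n k; rewrite /f; case: ifP => _.
    by rewrite normrM mulrC ler_wpM2r.
  by rewrite normr0 mulr_ge0// addr_ge0.
- exact: cvgP (cvg_series_scale _ ca).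
- move=> k; rewrite -(cvg_shiftn k.+1).
  apply: (@cvgn_ext _ (fun n => a k * series b n.+1)) => [n|].
    by rewrite /f /= ltn_addl// addnS subSn ?leq_addl// addnK.
  by apply: cvgn_scale; rewrite cvg_shiftS.
- rewrite mulrC; apply: (cvgn_ext _ (cvg_series_scale t as_)) => n.
  by congr series; apply/funext => i; rewrite mulrC.
Qed.

(** * Analytic continuation to the unit circle *)

Definition disc_cvg (R : realType) (a : nat -> R) : Prop :=
  forall z : R, `|z| < 1 -> cvgn (pseries a z).

Definition psum (R : realType) (a : nat -> R) (z : R) : R := limn (pseries a z).

(** The binomial series of exponent -2 serves as the convergent majorant of
    \sum_n (n + 1) x^n. *)
Lemma gbinomN2 (R : realType) n : gbinom (- 2 : R) n = (-1) ^+ n * n.+1%:R.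
Proof.
elim: n => [|n ih]; first by rewrite gbinom0 expr0 mul1r.
rewrite gbinomS ih exprS -[n.+2%:R]natr1 -[n.+1%:R]natr1; field.
by rewrite natr1 pnatr_eq0.
Qed.

Lemma disc_cvg_norm (R : realType) (a : nat -> R) (z : R) :
  disc_cvg a -> `|z| < 1 -> cvgn (series (fun n => `|a n * z ^+ n|)).
Proof.
move=> ha z1; pose x := (`|z| + 1) / 2.
have x0 : 0 < x by rewrite /x; have := normr_ge0 z; lra.
have xE : `|x| = x by exact: gtr0_norm.
have zx : `| `|z| | < `|x| by rewrite normr_id xE /x; lra.
have hx : cvgn (pseries a x) by apply: ha; rewrite xE /x; lra.
have := is_cvg_pseries_inside_norm hx zx.
suff -> : (fun n => `|a n * z ^+ n|) = (fun n => `|a n| * `|z| ^+ n) by [].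
by apply/funext => n; rewrite normrM normrX.
Qed.

Lemma summable_disc_cvg (R : realType) (a : nat -> R) :
  cvgn (series (fun n => `|a n|)) -> disc_cvg a.
Proof.
move=> ca z z1; apply: series_cvg_norm; apply: series_le_cvg ca => // n.
by rewrite normrM normrX ler_piMr// exprn_ile1// ltW.
Qed.

Lemma disc_cvg_diffs (R : realType) (a : nat -> R) :
  disc_cvg a -> disc_cvg (pseries_diffs a).
Proof.
move=> ha z z1; pose x := (`|z| + 1) / 2.
have x0 : 0 < x by rewrite /x; have := normr_ge0 z; lra.
have zx : `|z| < x by rewrite /x; lra.
have [M [_ Mb]] : bounded_fun (fun n => a n * x ^+ n).
  by apply: cvg_series_bounded; apply: ha; rewrite gtr0_norm// /x; lra.
have {}Mb n : `|a n| * x ^+ n <= `|M| + 1.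
  rewrite -(gtr0_norm x0) -normrX -normrM; apply: Mb => //.
  by rewrite (le_lt_trans (ler_norm M))// ltrDl.
have q1 : `| `|z| / x | < 1.
  by rewrite ger0_norm ?divr_ge0 ?(ltW x0)// ltr_pdivrMr// mul1r.
have := cvg_series_scale ((`|M| + 1) / x) (@is_cvg_gbinom_series _ (- 2) _ q1).
move/cvgP => h; apply: series_cvg_norm; apply: series_le_cvg h => //= n.
  by rewrite mulr_ge0// divr_ge0 ?addr_ge0// ltW.
have -> : `|gbinom (- 2) n * (`|z| / x) ^+ n| = n.+1%:R * (`|z| ^+ n / x ^+ n).
  have zx0 : 0 <= `|z| / x by rewrite divr_ge0// ltW.
  rewrite normrM [X in _ * X](ger0_norm (exprn_ge0 _ zx0)) expr_div_n.
  by rewrite gbinomN2 normrM normrX normrN1 expr1n mul1r [`|_%:R|]ger0_norm.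
rewrite /pseries_diffs 2!normrM normrX [`|n.+1%:R|]ger0_norm// -mulrA.
rewrite [leRHS]mulrCA ler_wpM2l//.
rewrite [leRHS](_ : _ = (`|M| + 1) / x ^+ n.+1 * `|z| ^+ n).
  by rewrite ler_wpM2r ?exprn_ge0// ler_pdivlMr ?exprn_gt0// ltW.
by rewrite exprS [(x * x ^+ n)^-1]invfM; move: (x^-1) ((x ^+ n)^-1) => u v; ring.
Qed.

Lemma is_derive_psum (R : realType) (a : nat -> R) (z : R) :
  disc_cvg a -> `|z| < 1 -> is_derive z (1 : R) (psum a) (psum (pseries_diffs a) z).
Proof.
move=> ha z1; pose x := (`|z| + 1) / 2.
have x0 : 0 < x by rewrite /x; have := normr_ge0 z; lra.
have x1 : `|x| < 1 by rewrite gtr0_norm// /x; lra.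
have zx : `|z| < `|x| by rewrite (gtr0_norm x0) /x; lra.
have ha' := disc_cvg_diffs ha.
exact: (pseries_snd_diffs (ha _ x1) (ha' _ x1) (disc_cvg_diffs ha' x1) zx).
Qed.

Lemma cvg_psum (R : realType) (a : nat -> R) (z : R) :
  disc_cvg a -> `|z| < 1 -> pseries a z @ \oo --> psum a z.
Proof. by move=> ha z1; exact: ha. Qed.

Lemma psum0 (R : realType) (a : nat -> R) : psum a 0 = a 0%N.
Proof.
apply/cvg_lim => //; rewrite -cvg_shiftS; apply: cvg_near_cst; apply: nearW => n.
by rewrite /= pseries_shiftE mul0r addr0.
Qed.

Lemma pseries_convE (R : realType) (a b : nat -> R) (z : R) :
  pseries (cauchy_product a b) z =
  series (cauchy_product (fun n => a n * z ^+ n) (fun n => b n * z ^+ n)).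
Proof.
congr series; apply/funext => n; rewrite /cauchy_product /= mulr_suml; apply: eq_bigr => i _.
have -> : z ^+ n = z ^+ i * z ^+ (n - i) by rewrite -exprD subnKC// -ltnS.
by ring.
Qed.

Lemma cvg_pseries_conv (R : realType) (a b : nat -> R) (z : R) :
  disc_cvg a -> disc_cvg b -> `|z| < 1 ->
  pseries (cauchy_product a b) z @ \oo --> psum a z * psum b z.
Proof.
move=> ha hb z1; rewrite pseries_convE; apply: cvg_series_conv.
- exact: disc_cvg_norm.
- exact: cvg_psum.
- exact: cvg_psum.
Qed.

Lemma psum_conv (R : realType) (a b : nat -> R) (z : R) :
  disc_cvg a -> disc_cvg b -> `|z| < 1 -> psum (cauchy_product a b) z = psum a z * psum b z.
Proof. by move=> ha hb z1; apply/cvg_lim => //; exact: cvg_pseries_conv. Qed.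

Lemma psum_lin (R : realType) (a b : R) (u v : nat -> R) (x : R) :
  disc_cvg u -> disc_cvg v -> `|x| < 1 ->
  psum (fun n => a * u n + b * v n) x = a * psum u x + b * psum v x.
Proof.
move=> hu hv x1; apply/cvg_lim => //.
have h1 := cvgn_scale a (cvg_psum hu x1).
have h2 := cvgn_scale b (cvg_psum hv x1).
have h3 : (fun n => a * pseries u x n + b * pseries v x n) @ \oo
  --> a * psum u x + b * psum v x by exact: cvgD.
apply: (cvgn_ext _ h3) => n.
rewrite /pseries/series/= !mulr_sumr -big_split/=; apply: eq_bigr => i _; ring.
Qed.

(** Abel summation; absolute convergence reduces it to Tannery's theorem. *)
Lemma abel_seq (R : realType) (a : nat -> R) (s : R) :
  cvgn (series (fun n => `|a n|)) -> series a @ \oo --> s ->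
  (fun m => psum a (1 - m.+1%:R^-1)) @ \oo --> s.
Proof.
move=> ca as_.
have r01 m : 0 <= 1 - (m.+1%:R^-1 : R) <= 1.
  by rewrite subr_ge0 invf_le1// ler1n/= gerBl invr_ge0 ler0n.
apply: (@cvg_series_dominated _ _ a (fun n => `|a n|)) => // [m k|k].
  have /andP[r0 r1] := r01 m.
  by rewrite normrM ler_piMr// normrX ger0_norm// exprn_ile1.
rewrite -[X in _ --> X]mulr1; apply: cvgn_scale.
have : (fun m => (1 - m.+1%:R^-1 : R) ^+ k) @ \oo --> (1 - 0 : R) ^+ k.
  apply: (cvgn_comp (fun x : R => x ^+ k)); first exact: exprn_continuous.
  by apply: cvgB; [exact: cvg_cst|exact: cvg_harmonic].
by rewrite subr0 expr1n.
Qed.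

(** The generating function F of p satisfies F' = t C' F on (0, 1); comparing
    coefficients turns this into a recursion, which no longer refers to real
    arguments. *)
Lemma exp_pseries_rec (R : realType) (p c : nat -> R) (t C1 : R) :
  disc_cvg p -> disc_cvg c ->
  (forall z, 0 <= z < 1 -> psum p z = expR (t * (psum c z - C1))) ->
  forall n, pseries_diffs p n = t * cauchy_product (pseries_diffs c) p n.
Proof.
move=> hp hc pE n; apply/eqP; rewrite -subr_eq0; apply/eqP.
have hdp := disc_cvg_diffs hp; have hdc := disc_cvg_diffs hc.
move: n; apply: pseries_eq0 => z /andP[z0 z1].
have nz : `|z| < 1 by rewrite gtr0_norm.
have dE : psum (pseries_diffs p) z = t * (psum (pseries_diffs c) z * psum p z).
  have d1 := is_derive_psum hp nz.
  have d2 : is_derive z (1 : R) (fun y => t * (psum c y - C1)) (t * psum (pseries_diffs c) z).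
    have := is_deriveZ t (is_deriveB (is_derive_psum hc nz) (is_derive_cst C1 z (1 : R))).
    by rewrite subr0.
  have d3 := @is_derive1_comp _ (@expR R) _ _ _ _ (is_derive_expR _) d2.
  have d4 : is_derive z (1 : R) (psum p) (expR (t * (psum c z - C1)) * (t * psum (pseries_diffs c) z)).
    apply: near_eq_is_derive d3.
    near=> y; rewrite pE//; apply/andP; split.
      by apply: ltW; near: y; exact: lt_nbhsr.
    by near: y; exact: lt_nbhsl.
  have e1 := @derive_val _ _ _ _ _ _ _ d1; have e2 := @derive_val _ _ _ _ _ _ _ d4.
  rewrite -e1 e2 pE ?(ltW z0)//; ring.
have h1 := cvg_psum hdp nz; have h2 := cvgn_scale t (cvg_pseries_conv hdc hp nz).
have h3 : (fun n => pseries (pseries_diffs p) z n - t * pseries (cauchy_product (pseries_diffs c) p) z n)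
    @ \oo --> psum (pseries_diffs p) z - t * (psum (pseries_diffs c) z * psum p z) by apply: cvgB.
rewrite dE subrr in h3; apply: (cvgn_ext _ h3) => n.
rewrite /pseries/series/= mulr_sumr -sumrB; apply: eq_bigr => i _; ring.
Unshelve. all: end_near. Qed.

Lemma is_derive_mul (R : realType) (f g : R -> R) (x a b : R) :
  is_derive x (1 : R) f a -> is_derive x (1 : R) g b ->
  is_derive x (1 : R) (fun y => f y * g y) (a * g x + f x * b).
Proof.
move=> df dg; apply: (is_derive_eq (is_deriveM df dg)).
by rewrite /GRing.scale/= addrC [a * _]mulrC.
Qed.

Lemma is_derive_add (R : realType) (f g : R -> R) (x a b : R) :
  is_derive x (1 : R) f a -> is_derive x (1 : R) g b ->
  is_derive x (1 : R) (fun y => f y + g y) (a + b).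
Proof. by move=> df dg; exact: is_deriveD. Qed.

Lemma is_derive_sub (R : realType) (f g : R -> R) (x a b : R) :
  is_derive x (1 : R) f a -> is_derive x (1 : R) g b ->
  is_derive x (1 : R) (fun y => f y - g y) (a - b).
Proof. by move=> df dg; exact: is_deriveB. Qed.

(** In complex notation, (h + i k)' = (a + i b)' (h + i k) is solved by
    h(0) exp (a + i b): the product (h + i k) exp (- (a + i b)) has derivative
    0.  Its real and imaginary parts are u and v in the proof. *)
Lemma linear_ode2 (R : realType) (h k a b da db : R -> R) :
  (forall x, `|x| < 1 -> is_derive x (1 : R) a (da x)) ->
  (forall x, `|x| < 1 -> is_derive x (1 : R) b (db x)) ->
  (forall x, `|x| < 1 -> is_derive x (1 : R) h (da x * h x - db x * k x)) ->
  (forall x, `|x| < 1 -> is_derive x (1 : R) k (da x * k x + db x * h x)) ->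
  a 0 = 0 -> b 0 = 0 -> k 0 = 0 ->
  forall x, `|x| < 1 -> h x = h 0 * (expR (a x) * cos (b x)) /\
                        k x = h 0 * (expR (a x) * sin (b x)).
Proof.
move=> hda hdb hdh hdk a0 b0 k0 x x1.
pose u y := expR (- a y) * (h y * cos (b y) + k y * sin (b y)).
pose v y := expR (- a y) * (k y * cos (b y) - h y * sin (b y)).
have dE y : `|y| < 1 -> is_derive y (1 : R) (fun z => expR (- a z)) (- da y * expR (- a y)).
  move=> y1; have d := is_deriveN (hda _ y1).
  have := @is_derive1_comp _ (@expR R) _ _ _ _ (is_derive_expR _) d.
  by rewrite mulrC.
have dC y : `|y| < 1 -> is_derive y (1 : R) (fun z => cos (b z)) (- sin (b y) * db y).
  by move=> y1; exact: (@is_derive1_comp _ (@cos R) _ _ _ _ (is_derive_cos _) (hdb _ y1)).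
have dS y : `|y| < 1 -> is_derive y (1 : R) (fun z => sin (b z)) (cos (b y) * db y).
  by move=> y1; exact: (@is_derive1_comp _ (@sin R) _ _ _ _ (is_derive_sin _) (hdb _ y1)).
have du y : y \in `](-1 : R), 1[ -> is_derive y (1 : R) u 0.
  rewrite in_itv/= -ltr_norml => y1.
  have d1 := is_derive_mul (hdh _ y1) (dC _ y1).
  have d2 := is_derive_mul (hdk _ y1) (dS _ y1).
  apply: (is_derive_eq (is_derive_mul (dE _ y1) (is_derive_add d1 d2))).
  rewrite /=; ring.
have dv y : y \in `](-1 : R), 1[ -> is_derive y (1 : R) v 0.
  rewrite in_itv/= -ltr_norml => y1.
  have d1 := is_derive_mul (hdk _ y1) (dC _ y1).
  have d2 := is_derive_mul (hdh _ y1) (dS _ y1).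
  apply: (is_derive_eq (is_derive_mul (dE _ y1) (is_derive_sub d1 d2))).
  rewrite /=; ring.
have xi : x \in `](-1), 1[ by move: x1; rewrite ltr_norml in_itv.
have zi : (0 : R) \in `](-1), 1[ by rewrite in_itv/=; apply/andP; split; lra.
have ux : u x = h 0.
  by rewrite (derive0_cst xi zi du) /u a0 b0 k0 oppr0 expR0 cos0 mul0r addr0 mulr1 mul1r.
have vx : v x = 0.
  by rewrite (derive0_cst xi zi dv) /v a0 b0 k0 sin0 mul0r mulr0 subrr mulr0.
have ee := expRxMexpNx_1 (a x); have cs := cos2Dsin2 (b x).
rewrite -ux; have {}vx : k x * cos (b x) - h x * sin (b x) = 0.
  by move/eqP: vx; rewrite /v mulf_eq0 gt_eqF ?expR_gt0//= => /eqP.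
split.
  rewrite /u; transitivity ((expR (a x) * expR (- a x)) * (h x * (cos (b x) ^+ 2 + sin (b x) ^+ 2)
    + sin (b x) * (k x * cos (b x) - h x * sin (b x)))).
    by rewrite ee cs vx; ring.
  ring.
rewrite /u; transitivity ((expR (a x) * expR (- a x)) * (k x * (cos (b x) ^+ 2 + sin (b x) ^+ 2)
    - cos (b x) * (k x * cos (b x) - h x * sin (b x)))).
  by rewrite ee cs vx; ring.
ring.
Qed.

(** Along the ray z = x e^(i theta) the recursion of [exp_pseries_rec] becomes
    h' = t g' h, where h and g are the sums of p_k e^(i k theta) x^k and
    c_k e^(i k theta) x^k.  Hence h = p_0 exp (t g) for x < 1, and p_0 is
    exp (- t C1); Abel summation gives the value at x = 1. *)
Lemma compound_poisson_cf (R : realType) (p c : nat -> R) (t C1 theta a b : R) :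
  (forall k, 0 <= p k) -> (forall k, 0 <= c k) -> c 0%N = 0 ->
  cvgn (series p) -> cvgn (series c) ->
  (forall z, 0 <= z < 1 -> psum p z = expR (t * (psum c z - C1))) ->
  series (fun k => c k * cos (theta * k%:R)) @ \oo --> a ->
  series (fun k => c k * sin (theta * k%:R)) @ \oo --> b ->
  series (fun k => p k * cos (theta * k%:R)) @ \oo --> expR (t * (a - C1)) * cos (t * b) /\
  series (fun k => p k * sin (theta * k%:R)) @ \oo --> expR (t * (a - C1)) * sin (t * b).
Proof.
move=> p0 c0 c00 cp cc pE ha hb.
have trig (f : R -> R) (q : nat -> R) : (forall x, `|f x| <= 1) -> (forall k, 0 <= q k) ->
    cvgn (series q) -> cvgn (series (fun k => `|q k * f (theta * k%:R)|)).
  move=> f1 q0 cq; apply: series_le_cvg cq => // k.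
  by rewrite normrM (ger0_norm (q0 k)) ler_piMr.
have cos1 (x : R) : `|cos x| <= 1 by rewrite ler_norml cos_geN1 cos_le1.
have sin1 (x : R) : `|sin x| <= 1 by rewrite ler_norml sin_geN1 sin_le1.
pose pc k := p k * cos (theta * k%:R); pose ps k := p k * sin (theta * k%:R).
pose gc k := c k * cos (theta * k%:R); pose gs k := c k * sin (theta * k%:R).
have spc := trig _ _ cos1 p0 cp; have sps := trig _ _ sin1 p0 cp.
have sgc := trig _ _ cos1 c0 cc; have sgs := trig _ _ sin1 c0 cc.
have hpc := summable_disc_cvg spc; have hps := summable_disc_cvg sps.
have hgc := summable_disc_cvg sgc; have hgs := summable_disc_cvg sgs.
have hp : disc_cvg p by apply: summable_disc_cvg; under eq_fun do rewrite ger0_norm//.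
have hc : disc_cvg c by apply: summable_disc_cvg; under eq_fun do rewrite ger0_norm//.
have rec := exp_pseries_rec hp hc pE.
have recc n : pseries_diffs pc n =
    t * cauchy_product (pseries_diffs gc) pc n + (- t) * cauchy_product (pseries_diffs gs) ps n.
  rewrite mulNr -mulrBr.
  rewrite /pseries_diffs {1}/pc mulrA -/(pseries_diffs p n) rec /cauchy_product -sumrB mulrAC -!mulrA.
  congr (_ * _); rewrite mulr_sumr; apply: eq_bigr => i _.
  have -> : theta * n.+1%:R = theta * i.+1%:R + theta * (n - i)%:R.
    by rewrite -mulrDr -natrD addSn subnKC// -ltnS.
  rewrite cosD /gc /gs /pc /ps /pseries_diffs; ring.
have recs n : pseries_diffs ps n =
    t * cauchy_product (pseries_diffs gc) ps n + t * cauchy_product (pseries_diffs gs) pc n.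
  rewrite -mulrDr.
  rewrite /pseries_diffs {1}/ps mulrA -/(pseries_diffs p n) rec /cauchy_product -big_split/= mulrAC -!mulrA.
  congr (_ * _); rewrite mulr_sumr; apply: eq_bigr => i _.
  have -> : theta * n.+1%:R = theta * i.+1%:R + theta * (n - i)%:R.
    by rewrite -mulrDr -natrD addSn subnKC// -ltnS.
  rewrite sinD /gc /gs /pc /ps /pseries_diffs; ring.
have hcv (u v : nat -> R) : disc_cvg u -> disc_cvg v -> disc_cvg (cauchy_product u v).
  by move=> hu hv z z1; apply: cvgP (cvg_pseries_conv hu hv z1).
have hdgc := disc_cvg_diffs hgc; have hdgs := disc_cvg_diffs hgs.
have dpc x : `|x| < 1 -> is_derive x (1 : R) (psum pc)
    (t * psum (pseries_diffs gc) x * psum pc x - t * psum (pseries_diffs gs) x * psum ps x).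
  move=> x1; apply: (is_derive_eq (is_derive_psum hpc x1)).
  rewrite (funext recc) psum_lin ?psum_conv//; [ring|exact: hcv|exact: hcv].
have dps x : `|x| < 1 -> is_derive x (1 : R) (psum ps)
    (t * psum (pseries_diffs gc) x * psum ps x + t * psum (pseries_diffs gs) x * psum pc x).
  move=> x1; apply: (is_derive_eq (is_derive_psum hps x1)).
  rewrite (funext recs) psum_lin ?psum_conv//; [ring|exact: hcv|exact: hcv].
have tscale (u : nat -> R) : disc_cvg u -> forall x, `|x| < 1 ->
    is_derive x (1 : R) (fun y => t * psum u y) (t * psum (pseries_diffs u) x).
  by move=> hu x x1; have := is_deriveZ t (is_derive_psum hu x1).
have ode := @linear_ode2 R (psum pc) (psum ps) (fun y => t * psum gc y)
  (fun y => t * psum gs y) _ _ (tscale _ hgc) (tscale _ hgs) dpc dps.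
have gc0 : t * psum gc 0 = 0 by rewrite psum0 /gc c00 mul0r mulr0.
have gs0 : t * psum gs 0 = 0 by rewrite psum0 /gs c00 mul0r mulr0.
have ps0 : psum ps 0 = 0 by rewrite psum0 /ps mulr0 sin0 mulr0.
have {}ode := ode gc0 gs0 ps0.
have pc0 : psum pc 0 = expR (- t * C1).
  rewrite psum0 /pc mulr0 cos0 mulr1 -psum0 pE ?lexx ?ltr01// psum0 c00.
  by rewrite sub0r mulrN mulNr.
have r1 m : `|1 - m.+1%:R^-1 : R| < 1.
  have h1 : (m.+1%:R^-1 : R) <= 1 by rewrite invf_le1 ?ler1n ?ltr0n.
  have h2 : 0 < (m.+1%:R^-1 : R) by rewrite invr_gt0 ltr0n.
  by rewrite ger0_norm ?subr_ge0//; lra.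
have lims (e : R -> R) : continuous e ->
    (fun m => psum pc 0 * (expR (t * psum gc (1 - m.+1%:R^-1)) * e (t * psum gs (1 - m.+1%:R^-1))))
    @ \oo --> expR (t * (a - C1)) * e (t * b).
  move=> ce.
  have -> : expR (t * (a - C1)) * e (t * b) = psum pc 0 * (expR (t * a) * e (t * b)).
    by rewrite mulrA pc0 -expRD; congr (expR _ * _); ring.
  apply: cvgn_scale; apply: cvgM.
    apply: (cvgn_comp expR); first exact: continuous_expR.
    by apply: cvgn_scale; exact: abel_seq.
  apply: (cvgn_comp e) => //.
  by apply: cvgn_scale; exact: abel_seq.
have final (u : nat -> R) (l : R) : cvgn (series (fun n => `|u n|)) ->
    (fun m => psum u (1 - m.+1%:R^-1)) @ \oo --> l -> series u @ \oo --> l.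
  move=> cu ul; have cu' := series_cvg_norm cu.
  suff -> : l = limn (series u) by [].
  by apply: (cvg_unique _ ul) => //; exact: abel_seq.
split; apply: final => //.
  by apply: (cvgn_ext _ (lims _ (@continuous_cos R))) => m; case: (ode _ (r1 m)).
by apply: (cvgn_ext _ (lims _ (@continuous_sin R))) => m; case: (ode _ (r1 m)).
Qed.

(** * Integration over countable partitions *)

Lemma eseries_EFin (R : realType) (u : nat -> R) (s : R) :
  series u @ \oo --> s -> (\sum_(k <oo) (u k)%:E = s%:E)%E.
Proof.
move=> us; apply: cvg_lim => //.
have -> : (fun n => (\sum_(0 <= k < n) (u k)%:E)%E) = EFin \o series u.
  by apply/funext => n /=; rewrite sumEFin.
by apply: cvg_EFin => //; exact: nearW.
Qed.

Lemma cvg_series_EFin (R : realType) (u : nat -> R) (s : R) :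
  (forall k, 0 <= u k) -> (\sum_(k <oo) (u k)%:E = s%:E)%E ->
  series u @ \oo --> s.
Proof.
move=> u0 us.
have h : (fun n => (\sum_(0 <= k < n) (u k)%:E)%E) @ \oo --> s%:E.
  rewrite -us; apply: is_cvg_nneseries => k _ _; exact: u0.
have {}h : EFin \o series u @ \oo --> s%:E.
  by apply: cvg_trans h; apply: near_eq_cvg; apply: nearW => n /=; rewrite sumEFin.
by move/fine_cvgP : h => [_].
Qed.

Lemma ge0_integral_partition (d : measure_display) (T : measurableType d)
    (R : realType) (m : {measure set T -> \bar R}) (E : nat -> set T)
    (a g : nat -> R) (f : T -> R) :
  (forall k, measurable (E k)) -> trivIset setT E ->
  m (~` \bigcup_k E k) = 0%E -> (forall k, m (E k) = (a k)%:E) ->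
  measurable_fun setT f -> (forall k x, E k x -> f x = g k) ->
  (forall x, 0 <= f x) ->
  (\int[m]_x (f x)%:E = \sum_(k <oo) (a k * g k)%:E)%E.
Proof.
move=> mE tE m0 aE mf fg f0.
have mU : measurable (\bigcup_k E k) by exact: bigcupT_measurable.
rewrite (ge0_negligible_integral (N := ~` \bigcup_k E k))//; last 3 first.
- exact: measurableC.
- exact/measurable_EFinP.
- by move=> x _; rewrite lee_fin.
rewrite setTD setCK ge0_integral_bigcup//; last 2 first.
- by apply: measurable_funTS; exact/measurable_EFinP.
- by move=> x _; rewrite lee_fin.
apply: eq_eseriesr => k _.
rewrite (@eq_integral _ _ _ _ _ (cst (g k)%:E)); last first.
  by move=> x; rewrite inE => /fg ->.
by rewrite integral_cst// aE -EFinM mulrC.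
Qed.

(** Used for the law of a random variable with values in the naturals as well as
    for measures carried by the naturals. *)
Lemma integral_partition (d : measure_display) (T : measurableType d)
    (R : realType) (m : {measure set T -> \bar R}) (E : nat -> set T)
    (a g : nat -> R) (f : T -> R) :
  (forall k, measurable (E k)) -> trivIset setT E ->
  m (~` \bigcup_k E k) = 0%E -> (forall k, m (E k) = (a k)%:E) ->
  measurable_fun setT f -> (forall k x, E k x -> f x = g k) ->
  cvgn (series (fun k => a k * `|g k|)) ->
  m.-integrable setT (EFin \o f) /\
  series (fun k => a k * g k) @ \oo --> Rintegral m setT f.
Proof.
move=> mE tE m0 aE mf fg cag.
have a0 k : 0 <= a k by rewrite -lee_fin -aE.
have int : m.-integrable setT (EFin \o f).
  apply/integrableP; split; first exact/measurable_EFinP.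
  rewrite [ltLHS](_ : _ = (\int[m]_x (`|f x|)%:E)%E)//.
  rewrite (@ge0_integral_partition _ _ _ m E a (fun k => `|g k|))//.
  - by rewrite (eseries_EFin cag) ltry.
  - exact: measurableT_comp.
  - by move=> k x /fg ->.
split => //.
have mU : measurable (\bigcup_k E k) by exact: bigcupT_measurable.
have sg : cvgn (series (fun k => a k * g k)).
  apply: series_cvg_norm; apply: series_le_cvg cag => // k.
    by rewrite mulr_ge0.
  by rewrite normrM (ger0_norm (a0 k)).
suff -> : Rintegral m setT f = limn (series (fun k => a k * g k)) by [].
rewrite /Rintegral (negligible_integral (N := ~` \bigcup_k E k))//; last exact: measurableC.
rewrite setTD setCK integral_bigcup//; last first.
  by apply: integrableS int.
rewrite (_ : (\sum_(i <oo) _)%E = (\sum_(k <oo) (a k * g k)%:E)%E); first by rewrite (eseries_EFin sg).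
apply: eq_eseriesr => k _.
rewrite (@eq_integral _ _ _ _ _ (cst (g k)%:E)); last first.
  by move=> x; rewrite inE /= => /fg ->.
by rewrite integral_cst// aE -EFinM mulrC.
Qed.

Lemma bounded_cvg_Rintegral (d : measure_display) (T : measurableType d)
    (R : realType) (m : {measure set T -> \bar R}) (f_ : nat -> T -> R)
    (f : T -> R) (C : R) :
  (m setT < +oo)%E -> (forall n, measurable_fun setT (f_ n)) ->
  measurable_fun setT f -> (forall n x, `|f_ n x| <= C) ->
  {ae m, forall x, f_ ^~ x @ \oo --> f x} ->
  (fun n => Rintegral m setT (f_ n)) @ \oo --> Rintegral m setT f.
Proof.
move=> mfin mf_ mf fC ff.
have iC : m.-integrable setT (EFin \o cst C).
  apply: measurable_bounded_integrable => //.
  by exists `|C|; split => // M CM x _ /=; exact: ltW.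
have [||||if_ _ h] := @dominated_convergence _ _ _ m setT measurableT
  (fun n => EFin \o f_ n) (EFin \o f) (EFin \o cst C) _ _ _ iC.
- by move=> n; exact/measurable_EFinP.
- exact/measurable_EFinP.
- by apply: filterS ff => x fx _; apply: cvg_EFin => //; exact: nearW.
- by apply: aeW => x n _; rewrite /= lee_fin.
have fin : (\int[m]_x (f x)%:E)%E \is a fin_num by exact: integrable_fin_num.
have : (fun n => (\int[m]_x (f_ n x)%:E)%E) @ \oo --> (Rintegral m setT f)%:E.
  by rewrite /Rintegral fineK.
by move/fine_cvgP => [_].
Qed.

Lemma Rintegral_sum (d : measure_display) (T : measurableType d)
    (R : realType) (m : {measure set T -> \bar R}) (f : nat -> T -> R) n :
  (forall j, m.-integrable setT (EFin \o f j)) ->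
  m.-integrable setT (EFin \o (fun x => \sum_(j < n) f j x)) /\
  Rintegral m setT (fun x => \sum_(j < n) f j x) =
  \sum_(j < n) Rintegral m setT (f j).
Proof.
move=> fi; elim: n => [|n [ih1 ih2]].
  rewrite big_ord0; under eq_fun do rewrite big_ord0; split; first exact: integrable0.
  by rewrite /Rintegral integral0.
have e : (fun x => \sum_(j < n.+1) f j x) = (fun x => \sum_(j < n) f j x + f n x).
  by apply/funext => x; rewrite big_ord_recr.
rewrite e big_ord_recr/= -ih2 -RintegralD//; split => //.
exact: (integrableD measurableT ih1 (fi n)).
Qed.

Lemma Rintegral_indic (d : measure_display) (T : measurableType d)
    (R : realType) (m : {measure set T -> \bar R}) (A : set T) :
  measurable A -> Rintegral m setT \1_A = fine (m A).
Proof. by move=> mA; rewrite /Rintegral integral_indic// setIT. Qed.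

(** * Finite measures carried by the integers *)

Lemma cos2pi_nat (R : realType) n : cos (pi *+ 2 * n%:R) = 1 :> R.
Proof.
by rewrite mulr_natr -[_ *+ n]add0r periodicn ?cos0//; exact: cosD2pi.
Qed.

Lemma cos2pi_int1 (R : realType) (x : R) : x \is a Num.int -> cos (pi *+ 2 * x) = 1.
Proof.
move=> xi; have /natrP[n xn] := natr_norm_int xi.
rewrite -(cos2pi_nat R n) -xn; case: (ger0P x) => // _.
by rewrite mulrN cosN.
Qed.

Lemma cos2pi_eq1 (R : realType) (x : R) : cos (pi *+ 2 * x) = 1 -> x \is a Num.int.
Proof.
have /andP[fx xf] := floor_itv x; pose z : R := (Num.floor x)%:~R; pose y := x - z.
have zi : z \is a Num.int by exact: intr_int.
have y0 : 0 <= y by rewrite subr_ge0.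
have y1 : y < 1 by rewrite ltrBlDl -intrD1.
have cz := cos2pi_int1 zi.
have sz : sin (pi *+ 2 * z) = 0.
  have := cos2Dsin2 (pi *+ 2 * z); rewrite cz expr1n => /eqP.
  by rewrite -subr_eq0 addrAC subrr add0r sqrf_eq0 => /eqP.
have -> : pi *+ 2 * x = pi *+ 2 * y + pi *+ 2 * z by rewrite -mulrDr subrK.
rewrite cosD cz sz mulr0 subr0 mulr1 => c1.
have [y0'|y0'] := eqVneq y 0.
  by move/eqP: y0'; rewrite subr_eq0 => /eqP ->.
have s0 : 0 < sin (pi * y).
  have yp : 0 < y by rewrite lt_neqAle eq_sym y0'.
  by apply: sin_gt0_pi; rewrite mulr_gt0 ?pi_gt0//= gtr_pMr ?pi_gt0.
move: c1; rewrite mulr2n mulrDl cosD => c1.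
have := cos2Dsin2 (pi * y); rewrite -[in RHS]c1 => h.
have : sin (pi * y) ^+ 2 = 0 by lra.
by move/eqP; rewrite sqrf_eq0 => /eqP e; rewrite e ltxx in s0.
Qed.

(** After multiplication by 2 sin (pi m / n) the sum telescopes. *)
Lemma sum_cos_eq0 (R : realType) (n m : nat) : (0 < m < n)%N ->
  \sum_(j < n) cos (pi *+ 2 * (j%:R / n%:R) * m%:R) = 0 :> R.
Proof.
move=> /andP[m0 mn]; have n0 : (0 < n)%N by exact: leq_trans mn.
pose a : R := pi * m%:R / n%:R.
have nn : n%:R != 0 :> R by rewrite pnatr_eq0 -lt0n.
have a0 : 0 < a < pi.
  rewrite divr_gt0 ?mulr_gt0 ?pi_gt0 ?ltr0n//= ltr_pdivrMr ?ltr0n//.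
  by rewrite ltr_pM2l ?pi_gt0// ltr_nat.
have sa := sin_gt0_pi a0.
apply: (@mulfI _ (2 * sin a)); first by rewrite mulf_neq0// gt_eqF.
have step k : \sum_(j < k) 2 * sin a * cos (pi *+ 2 * (j%:R / n%:R) * m%:R) =
    sin (k%:R *+ 2 * a - a) + sin a.
  elim: k => [|k ih]; first by rewrite big_ord0 mul0rn mul0r sub0r sinN addNr.
  rewrite big_ord_recr/= ih.
  have -> : pi *+ 2 * (k%:R / n%:R) * m%:R = k%:R *+ 2 * a :> R by rewrite /a; field.
  have -> : k.+1%:R *+ 2 * a - a = k%:R *+ 2 * a + a by rewrite -natr1; ring.
  by rewrite sinB sinD; ring.
rewrite mulr_sumr step mulr0.
have -> : n%:R *+ 2 * a = pi *+ 2 *+ m by rewrite /a -[in RHS]mulr_natr; field.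
rewrite [pi *+ 2 *+ m - a]addrC periodicn; last exact: sinD2pi.
by rewrite sinN addNr.
Qed.

(** On the integers this is the indicator of the multiples of n; only
    frequencies that are multiples of 2 pi / n occur in it. *)
Definition avg_cos (R : realType) (n : nat) (x : R) : R :=
  n%:R^-1 * \sum_(j < n) cos (pi *+ 2 * (j%:R / n%:R) * x).

Lemma avg_cos_int (R : realType) (x : R) : x \is a Num.int ->
  (fun n => avg_cos n.+1 x) @ \oo --> ((x == 0)%:R : R).
Proof.
move=> xi; have [x0|x0] := eqVneq x 0.
  apply: cvg_near_cst; apply: nearW => n; rewrite x0 /avg_cos.
  under eq_bigr do rewrite mulr0 cos0.
  by rewrite sumr_const card_ord mulVf// pnatr_eq0.
have /natrP[m xm] := natr_norm_int xi.
have m0 : (0 < m)%N by rewrite -(ltr_nat R) -xm normr_gt0.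
apply: cvg_near_cst; near=> n.
have mn : (m < n.+1)%N by rewrite ltnS; near: n; exact: nbhs_infty_ge.
rewrite /avg_cos (eq_bigr (fun j : 'I_n.+1 => cos (pi *+ 2 * (j%:R / n.+1%:R) * m%:R))).
  by rewrite sum_cos_eq0 ?m0// mulr0.
move=> j _; rewrite -xm; case: (ger0P x) => // _.
by rewrite mulrN cosN.
Unshelve. all: end_near. Qed.

Lemma avg_cos_le1 (R : realType) n (x : R) : `|avg_cos n.+1 x| <= 1.
Proof.
rewrite /avg_cos normrM ger0_norm ?invr_ge0// ler_pdivrMl ?ltr0n// mulr1.
apply: le_trans (ler_norm_sum _ _ _) _.
apply: (@le_trans _ _ (\sum_(j < n.+1) 1)).
  by apply: ler_sum => j _; rewrite ler_norml cos_geN1 cos_le1.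
by rewrite sumr_const card_ord.
Qed.

Lemma continuous_cosM (R : realType) (a : R) : continuous (fun x : R => cos (a * x)).
Proof.
move=> x; apply: continuous_comp; last exact: continuous_cos.
exact: mulrl_continuous.
Qed.

Lemma continuous_sinM (R : realType) (a : R) : continuous (fun x : R => sin (a * x)).
Proof.
move=> x; apply: continuous_comp; last exact: continuous_sin.
exact: mulrl_continuous.
Qed.

Lemma measurable_avg_cos (R : realType) n (k : R) :
  measurable_fun setT (fun x : R => avg_cos n (x - k)).
Proof.
apply: measurable_funM => //; apply: measurable_sum => j.
have ck : continuous (fun x : R => x - k).
  by move=> x; apply: cvgB; [exact: cvg_id|exact: cvg_cst].
apply: continuous_measurable_fun => x.
exact: (@continuous_comp R R R (fun y => y - k) (fun y => cos (pi *+ 2 * (j%:R / n%:R) * y)) x (ck x) (@continuous_cosM R _ _)).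
Qed.

Lemma measurable_int_set (R : realType) :
  measurable ([set x : R | x \is a Num.int] : set (measurableTypeR R)).
Proof.
have -> : [set x : R | x \is a Num.int] = (fun x : R => cos (pi *+ 2 * x)) @^-1` [set 1].
  by apply/seteqP; split => x /=; [exact: cos2pi_int1|exact: cos2pi_eq1].
rewrite -[X in measurable X]setTI.
have := continuous_measurable_fun (@continuous_cosM R (pi *+ 2)).
by apply => //; exact: measurable_set1.
Qed.

(** Integrating [avg_cos] centred at k, which tends to the indicator of k on the
    integers, recovers the atom at k.  Subtracting the value of the kernel at
    x = 0, which vanishes in the limit because k is not 0, leaves only the
    integrals of cos (th x) - 1 and sin (th x), i.e. the characteristic
    exponent. *)
Lemma lattice_atom_cvg (R : realType) (nu : {measure set (measurableTypeR R) -> \bar R})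
    (k : R) :
  (nu setT < +oo)%E -> nu (~` [set x : R | x \is a Num.int]) = 0%E ->
  k \is a Num.int -> k != 0 ->
  (fun n => n.+1%:R^-1 * \sum_(j < n.+1)
     (let th := pi *+ 2 * (j%:R / n.+1%:R) in
      cos (th * k) * Rintegral nu setT (fun x : R => cos (th * x) - 1) +
      sin (th * k) * Rintegral nu setT (fun x : R => sin (th * x))))
    @ \oo --> fine (nu [set k]).
Proof.
move=> nufin nuZ ki k0.
have int (f : R -> R) C : continuous f -> (forall x, `|f x| <= C) ->
    nu.-integrable setT (EFin \o f).
  move=> cf fC; apply: measurable_bounded_integrable => //.
    exact: continuous_measurable_fun.
  by exists C; split; rewrite ?num_real// => M CM x _ /=; apply: le_trans (fC x) (ltW CM).
have ic th : nu.-integrable setT (EFin \o (fun x : R => cos (th * x) - 1)).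
  apply: (int _ 2).
    by move=> x; apply: cvgB; [exact: continuous_cosM|exact: cvg_cst].
  move=> x; apply: le_trans (ler_normB _ _) _; rewrite normr1 -[2]/(1 + 1) lerD2r.
  by rewrite ler_norml cos_geN1 cos_le1.
have isn th : nu.-integrable setT (EFin \o (fun x : R => sin (th * x))).
  apply: (int _ 1); first exact: continuous_sinM.
  by move=> x; rewrite ler_norml sin_geN1 sin_le1.
pose G n (x : R) := avg_cos n.+1 (x - k) - avg_cos n.+1 k.
rewrite -(Rintegral_indic nu (measurable_set1 k)).
have GE n : Rintegral nu setT (G n) = n.+1%:R^-1 * \sum_(j < n.+1)
     (let th := pi *+ 2 * (j%:R / n.+1%:R) in
      cos (th * k) * Rintegral nu setT (fun x : R => cos (th * x) - 1) +
      sin (th * k) * Rintegral nu setT (fun x : R => sin (th * x))).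
  pose th j : R := pi *+ 2 * (j%:R / n.+1%:R).
  pose F j (x : R) := cos (th j * k) * (cos (th j * x) - 1) + sin (th j * k) * sin (th j * x).
  have iF1 j := integrableZl measurableT (cos (th j * k)) (ic (th j)).
  have iF2 j := integrableZl measurableT (sin (th j * k)) (isn (th j)).
  have iF j : nu.-integrable setT (EFin \o F j).
    exact: (integrableD measurableT (iF1 j) (iF2 j)).
  have -> : G n = fun x => n.+1%:R^-1 * \sum_(j < n.+1) F j x.
    apply/funext => x; rewrite /G /avg_cos -mulrBr -sumrB; congr (_ * _).
    apply: eq_bigr => j _; rewrite -/(th j) mulrBr cosB /F; ring.
  have [iS SE] := Rintegral_sum n.+1 iF.
  rewrite RintegralZl// SE; congr (_ * _); apply: eq_bigr => j _.
  rewrite /F RintegralD//; [|exact: iF1|exact: iF2].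
  by rewrite (RintegralZl _ _ (ic _))// (RintegralZl _ _ (isn _)).
apply: (cvgn_ext GE).
apply: (@bounded_cvg_Rintegral _ _ _ nu G _ 2) => //.
- by move=> n; apply: measurable_funB => //; exact: measurable_avg_cos.
- move=> n x; apply: le_trans (ler_normB _ _) _.
  by rewrite -[2]/(1 + 1) lerD// avg_cos_le1.
- exists (~` [set x : R | x \is a Num.int]); split => //.
    by apply: measurableC; exact: measurable_int_set.
  apply: subsetC => x /= xi.
  have h := cvgB (avg_cos_int (rpredB xi ki)) (avg_cos_int ki).
  have -> : \1_[set k] x = (x - k == 0)%:R - (k == 0)%:R :> R.
    rewrite (negbTE k0) subr0 subr_eq0 indicE; congr ((nat_of_bool _)%:R).
    by apply/idP/eqP; rewrite inE.
  exact: h.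
Qed.

(** The integrand has constant sign and vanishes exactly at the integers. *)
Lemma carried_by_int (R : realType) (nu : {measure set (measurableTypeR R) -> \bar R}) :
  nu.-integrable setT (EFin \o (fun x : R => cos (pi *+ 2 * x) - 1)) ->
  Rintegral nu setT (fun x : R => cos (pi *+ 2 * x) - 1) = 0 ->
  nu (~` [set x : R | x \is a Num.int]) = 0%E.
Proof.
move=> ic i0; pose f (x : R) : \bar R := (cos (pi *+ 2 * x) - 1)%:E.
have mf : measurable_fun setT f by have /integrableP[] := ic.
have f0 : (\int[nu]_x f x = 0)%E.
  by rewrite -[LHS]fineK ?integrable_fin_num// -/(Rintegral nu setT _) i0.
have : (\int[nu]_x `|f x| = 0)%E.
  have -> : (fun x => `|f x|%E) = (fun x => (- f x)%E).
    apply/funext => x; rewrite /f lee0_abs// lee_fin subr_le0; exact: cos_le1.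
  under eq_integral do rewrite -mulN1e.
  by rewrite (integralZl measurableT ic) f0 mule0.
move/(ae_eq_integral_abs nu measurableT mf) => [N [mN N0 sN]].
apply/eqP; rewrite -measure_le0 -N0; apply: le_measure; rewrite ?inE//.
  by apply: measurableC; exact: measurable_int_set.
move=> x xi; apply: sN => /(_ I) /= [] /eqP; rewrite subr_eq0 => /eqP c1.
by apply: xi; exact: cos2pi_eq1.
Qed.

Lemma lattice_measure_atoms (R : realType)
    (nu nu' : {measure set (measurableTypeR R) -> \bar R}) (k : R) :
  (nu setT < +oo)%E -> nu (~` [set x : R | x \is a Num.int]) = 0%E ->
  (nu' setT < +oo)%E -> nu' (~` [set x : R | x \is a Num.int]) = 0%E ->
  (forall th : R, Rintegral nu setT (fun x : R => cos (th * x) - 1) =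
                  Rintegral nu' setT (fun x : R => cos (th * x) - 1)) ->
  (forall th : R, Rintegral nu setT (fun x : R => sin (th * x)) =
                  Rintegral nu' setT (fun x : R => sin (th * x))) ->
  k \is a Num.int -> k != 0 -> nu [set k] = nu' [set k].
Proof.
move=> nf nZ nf' nZ' ec es ki k0.
have fin (m : {measure set (measurableTypeR R) -> \bar R}) :
    (m setT < +oo)%E -> m [set k] \is a fin_num.
  move=> mf; rewrite ge0_fin_numE//; apply: le_lt_trans mf.
  by apply: le_measure; rewrite ?inE.
rewrite -[LHS]fineK ?fin// -[RHS]fineK ?fin//; congr EFin.
have h := lattice_atom_cvg nf nZ ki k0; have h' := lattice_atom_cvg nf' nZ' ki k0.
apply: (cvg_unique _ h); first exact: Rhausdorff.
apply: (cvgn_ext _ h') => n; congr (_ * _); apply: eq_bigr => j _ /=.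
by rewrite ec es.
Qed.

(** * A Poisson process at an independent time *)

(** Unlike [poisson_pmf], this formula also gives the
    unit mass at 0 when x = 0, which makes it continuous on [0, +oo[. *)
Definition pois (R : realType) (k : nat) (x : R) : R :=
  x ^+ k / k`!%:R * expR (- x).

Lemma pois_ge0 (R : realType) k (x : R) : 0 <= x -> 0 <= pois k x.
Proof.
by move=> x0; rewrite /pois mulr_ge0 ?expR_ge0// divr_ge0// exprn_ge0.
Qed.

Lemma pois_gen (R : realType) (x z : R) :
  series (fun k => pois k x * z ^+ k) @ \oo --> expR (- (x * (1 - z))).
Proof.
have -> : - (x * (1 - z)) = - x + x * z by ring.
rewrite expRD.
have h : series (exp_coeff (x * z)) @ \oo --> expR (x * z).
  exact: is_cvg_series_exp_coeff.
apply: (cvgn_ext _ (cvg_series_scale (expR (- x)) h)) => n.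
by congr series; apply/funext => k; rewrite /exp_coeff/= /pois exprMn; ring.
Qed.

Lemma pois_sum1 (R : realType) (x : R) :
  series (fun k => pois k x) @ \oo --> (1 : R).
Proof.
have := @pois_gen R x 1; rewrite subrr mulr0 oppr0 expR0 => h.
apply: (cvgn_ext _ h) => n; congr series; apply/funext => k.
by rewrite expr1n mulr1.
Qed.

Lemma pois_le1 (R : realType) k (x : R) : 0 <= x -> pois k x <= 1.
Proof.
move=> x0; have h := @pois_sum1 R x.
have nd : nondecreasing_seq (series (fun k => pois k x)).
  by apply: nondecreasing_series => n _ _; exact: pois_ge0.
have := nondecreasing_cvgn_le nd (cvgP _ h) k.+1.
rewrite (cvg_lim _ h)//; apply: le_trans.
by rewrite seriesSr lerDr sumr_ge0// => i _; exact: pois_ge0.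
Qed.

Lemma continuous_pois (R : realType) k : continuous (@pois R k).
Proof.
move=> x; apply: cvgM.
  by apply: cvgM; [exact: exprn_continuous|exact: cvg_cst].
apply: continuous_comp; last exact: continuous_expR.
exact: opp_continuous.
Qed.

Lemma measurable_partition (d : measure_display) (T : measurableType d)
    (R : realType) (E : nat -> set T) (h : nat -> T -> R) (f : T -> R) :
  (forall j, measurable (E j)) -> (forall x, exists j, E j x) ->
  (forall j, measurable_fun setT (h j)) -> (forall j x, E j x -> f x = h j x) ->
  measurable_fun setT f.
Proof.
move=> mE cE mh fh _ B mB; rewrite setTI.
have -> : f @^-1` B = \bigcup_j (E j `&` h j @^-1` B).
  apply/seteqP; split => x /=.
    move=> Bfx; have [j Ejx] := cE x; exists j => //; split => //=.
    by rewrite -(fh _ _ Ejx).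
  by move=> [j _ [Ejx]] /=; rewrite -(fh _ _ Ejx).
apply: bigcupT_measurable => j; apply: measurableI => //.
by rewrite -[X in measurable X]setTI; exact: mh.
Qed.

(** Gathers what the law of N at the random time S depends on: the one-dimensional
    laws of N, the independence of each N s from S, and right-continuity. *)
Record poisson_time_change (d : measure_display) (T : measurableType d)
    (R : realType) (P : probability T R) (lambda : R) (N : R -> T -> R)
    (S : T -> R) : Prop := {
  ptc_measurable_time : measurable_fun setT S;
  ptc_time_ge0 : forall w, 0 <= S w;
  ptc_measurable : forall s, 0 <= s -> measurable_fun setT (N s);
  ptc_right_continuous : forall w s, 0 <= s -> N u w @[u --> s^'+] --> N s w;
  ptc_marginal : forall s k, 0 < s ->
    P [set w | N s w = k%:R] = (pois k (lambda * s))%:E;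
  ptc_independent : forall s A B, 0 <= s -> measurable A -> measurable B ->
    (P ([set w | A (N s w)] `&` [set w | B (S w)]) =
     P [set w | A (N s w)] * P [set w | B (S w)])%E }.

Definition grid (R : realType) (n j : nat) : R := j.+1%:R / n.+1%:R.

Definition grid_cell (R : realType) (n j : nat) : set R :=
  [set x | j%:R <= n.+1%:R * x < j.+1%:R].

(** The next grid point lies strictly to the right, the side on which the paths
    of N are continuous. *)
Definition grid_above (R : realType) (n : nat) (x : R) : R :=
  grid R n (Num.truncn (n.+1%:R * x)).

Lemma grid_gt0 (R : realType) n j : 0 < grid R n j.
Proof. by rewrite divr_gt0 ?ltr0n. Qed.

Lemma grid_cellP (R : realType) n j (x : R) :
  grid_cell n j x -> Num.truncn (n.+1%:R * x) = j.
Proof. exact: truncn_def. Qed.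

Lemma grid_cell_truncn (R : realType) n (x : R) : 0 <= x ->
  grid_cell n (Num.truncn (n.+1%:R * x)) x.
Proof. by move=> x0; apply: truncn_itv; rewrite mulr_ge0. Qed.

Lemma measurable_grid_cell (R : realType) n j : measurable (@grid_cell R n j).
Proof.
have -> : @grid_cell R n j = `[j%:R / n.+1%:R, j.+1%:R / n.+1%:R[%classic.
  apply/seteqP; split => x /=; rewrite in_itv/= /grid_cell/=;
  by rewrite ler_pdivrMr ?ltr_pdivlMr ?ltr0n// mulrC.
exact: measurable_itv.
Qed.

Lemma grid_above_gt (R : realType) n (x : R) : 0 <= x -> x < grid_above n x.
Proof.
move=> /(@grid_cell_truncn R n) /andP[_ h].
by rewrite /grid_above /grid ltr_pdivlMr ?ltr0n// mulrC.
Qed.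

Lemma grid_above_cvg (R : realType) (x : R) : 0 <= x ->
  (fun n => grid_above n x) @ \oo --> x.
Proof.
move=> x0; apply: (@squeeze_cvgr _ _ _ _ (fun=> x) (fun n => x + n.+1%:R^-1)).
- apply: nearW => n; rewrite ltW ?grid_above_gt//=.
  have /andP[h _] := grid_cell_truncn n x0.
  rewrite /grid_above /grid -natr1 mulrDl mul1r lerD2r ler_pdivrMr ?ltr0n//.
  by rewrite [leRHS]mulrC.
- exact: cvg_cst.
- rewrite -[X in _ --> X]addr0; apply: cvgD; first exact: cvg_cst.
  exact: cvg_harmonic.
Qed.

Lemma measurable_event_eq (d : measure_display) (T : measurableType d)
    (R : realType) (X : T -> R) (r : R) :
  measurable_fun setT X -> measurable [set w | X w = r].
Proof.
move=> mX; rewrite -[X in measurable X]setTI.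
exact: (mX measurableT [set r] (measurable_set1 r)).
Qed.

Lemma trivIset_nat_fibers (T : Type) (R : realType) (X : T -> R) :
  trivIset setT (fun k : nat => [set w | X w = k%:R]).
Proof.
apply/trivIsetP => i j _ _ ij; apply/seteqP; split => w //= [-> /eqP].
by rewrite eqr_nat (negbTE ij).
Qed.

Lemma ptc_natural (d : measure_display) (T : measurableType d)
    (R : realType) (P : probability T R) (lambda : R) (N : R -> T -> R)
    (S : T -> R) (s : R) :
  poisson_time_change P lambda N S -> 0 < s ->
  {ae P, forall w, exists k, N s w = k%:R}.
Proof.
move=> H s0; have mN := ptc_measurable H (ltW s0).
have mE k : measurable [set w | N s w = k%:R] by exact: measurable_event_eq.
exists (~` \bigcup_k [set w | N s w = k%:R]); split.
- by apply: measurableC; exact: bigcupT_measurable.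
- rewrite probability_setC; last exact: bigcupT_measurable.
  rewrite measure_semi_bigcup//; last exact: bigcupT_measurable.
    rewrite (eq_eseriesr (fun k _ => ptc_marginal H k s0)).
    by rewrite (eseries_EFin (@pois_sum1 R (lambda * s))) subee.
  exact: trivIset_nat_fibers.
- by apply: subsetC => w [k _ /= e]; exists k.
Qed.

Lemma ptc_measurable_cell (d : measure_display) (T : measurableType d)
    (R : realType) (P : probability T R) (lambda : R) (N : R -> T -> R)
    (S : T -> R) n j :
  poisson_time_change P lambda N S -> measurable (S @^-1` grid_cell n j).
Proof.
move=> H; rewrite -[X in measurable X]setTI.
have mS := ptc_measurable_time H.
apply: mS => //.
exact: measurable_grid_cell.
Qed.

Lemma ptc_measurable_above (d : measure_display) (T : measurableType d)
    (R : realType) (P : probability T R) (lambda : R) (N : R -> T -> R)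
    (S : T -> R) n :
  poisson_time_change P lambda N S ->
  measurable_fun setT (fun w => N (grid_above n (S w)) w).
Proof.
move=> H; apply: (@measurable_partition _ _ _ (fun j => S @^-1` grid_cell n j)
  (fun j => N (grid R n j))).
- by move=> j; exact: ptc_measurable_cell H.
- by move=> w; eexists; apply: grid_cell_truncn; exact: ptc_time_ge0 H _.
- by move=> j; apply: (ptc_measurable H); exact: ltW (grid_gt0 _ _ _).
- by move=> j w /= /grid_cellP jw; rewrite /grid_above jw.
Qed.

Lemma ptc_above_cvg (d : measure_display) (T : measurableType d)
    (R : realType) (P : probability T R) (lambda : R) (N : R -> T -> R)
    (S : T -> R) w :
  poisson_time_change P lambda N S ->
  (fun n => N (grid_above n (S w)) w) @ \oo --> N (S w) w.
Proof.
move=> H; have S0 := ptc_time_ge0 H w.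
have /cvg_at_rightP := @ptc_right_continuous _ _ _ _ _ _ _ H w _ S0.
apply; split => [n|]; first exact: grid_above_gt.
exact: grid_above_cvg.
Qed.

Lemma ptc_measurable_subordinated (d : measure_display) (T : measurableType d)
    (R : realType) (P : probability T R) (lambda : R) (N : R -> T -> R)
    (S : T -> R) :
  poisson_time_change P lambda N S -> measurable_fun setT (fun w => N (S w) w).
Proof.
move=> H; apply: (@measurable_fun_cvg _ _ _ _ (fun n w => N (grid_above n (S w)) w)).
- by move=> n; exact: ptc_measurable_above H.
- by move=> w _; exact: ptc_above_cvg H.
Qed.

(** On the event that S lies in a given cell the rounded time is deterministic,
    so that the independence of N s and S applies cell by cell. *)
Lemma ptc_above_law (d : measure_display) (T : measurableType d)
    (R : realType) (P : probability T R) (lambda : R) (N : R -> T -> R)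
    (S : T -> R) n k :
  0 < lambda -> poisson_time_change P lambda N S ->
  fine (P [set w | N (grid_above n (S w)) w = k%:R]) =
  Rintegral P setT (fun w => pois k (lambda * grid_above n (S w))).
Proof.
move=> l0 H; pose E j := S @^-1` grid_cell n j.
have mE j : measurable (E j) by exact: ptc_measurable_cell H.
have mN j : measurable [set w | N (grid R n j) w = k%:R].
  by apply: measurable_event_eq; apply: (ptc_measurable H); exact: ltW (grid_gt0 _ _ _).
have cE w : exists j, E j w.
  by eexists; apply: grid_cell_truncn; exact: ptc_time_ge0 H _.
have tE : trivIset setT E.
  apply/trivIsetP => i j _ _ ij; apply/seteqP; split => w //= [].
  move=> /grid_cellP ei /grid_cellP ej.
  by rewrite -ei -ej eqxx in ij.
have PE j : P (E j) = (fine (P (E j)))%:E by rewrite fineK// fin_num_measure.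
have -> : [set w | N (grid_above n (S w)) w = k%:R] =
    \bigcup_j ([set w | N (grid R n j) w = k%:R] `&` E j).
  apply/seteqP; split => w /=.
    move=> e; have [j Ej] := cE w; exists j => //; split => //=.
    by rewrite -e /grid_above (grid_cellP Ej).
  by move=> [j _ [/= <- /grid_cellP Ej]]; rewrite /grid_above Ej.
rewrite measure_semi_bigcup//; last 3 first.
- by move=> j; exact: measurableI.
- exact: trivIset_setIl.
- by apply: bigcupT_measurable => j; exact: measurableI.
rewrite /Rintegral (@ge0_integral_partition _ _ _ P E (fun j => fine (P (E j)))
   (fun j => pois k (lambda * grid R n j)))//.
- congr fine; apply: eq_eseriesr => j _.
  transitivity (P [set w | N (grid R n j) w = k%:R] * P (E j))%E.
    exact: (ptc_independent H (ltW (grid_gt0 R n j))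
      (measurable_set1 (k%:R : R)) (measurable_grid_cell n j)).
  by rewrite (ptc_marginal H) ?grid_gt0// [X in (_ * X)%E]PE -EFinM mulrC.
- by rewrite (_ : \bigcup_j E j = setT) ?setCT ?measure0//; apply/seteqP; split => w // _;
    have [j Ej] := cE w; exists j.
- apply: (@measurable_partition _ _ _ E (fun j => cst (pois k (lambda * grid R n j)))) => //.
  by move=> j w /grid_cellP Ej; rewrite /grid_above Ej.
- by move=> j w /grid_cellP Ej; rewrite /grid_above Ej.
- by move=> w; apply: pois_ge0; rewrite mulr_ge0 ?(ltW l0)// ltW// grid_gt0.
Qed.

(** Let the mesh of the grid go to 0 in [ptc_above_law].  The left side converges
    because almost surely N takes natural values at all grid points: a convergent
    sequence of naturals is eventually equal to its limit or stays away from k. *)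
Lemma ptc_law (d : measure_display) (T : measurableType d)
    (R : realType) (P : probability T R) (lambda : R) (N : R -> T -> R)
    (S : T -> R) k :
  0 < lambda -> poisson_time_change P lambda N S ->
  fine (P [set w | N (S w) w = k%:R]) =
  Rintegral P setT (fun w => pois k (lambda * S w)).
Proof.
move=> l0 H; have P1 : (P setT < +oo)%E by rewrite probability_setT ltry.
have mA n : measurable [set w | N (grid_above n (S w)) w = k%:R].
  by apply: measurable_event_eq; exact: ptc_measurable_above H.
have mX : measurable [set w | N (S w) w = k%:R].
  by apply: measurable_event_eq; exact: ptc_measurable_subordinated H.
have mpois (f : T -> R) : measurable_fun setT f ->
    measurable_fun setT (fun w => pois k (lambda * f w)).
  move=> mf; apply: measurableT_comp; last by apply: measurable_funM.
  exact: continuous_measurable_fun (@continuous_pois R k).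
have mD n : measurable_fun setT (fun w => grid_above n (S w)).
  apply: (@measurable_partition _ _ _ (fun j => S @^-1` grid_cell n j)
    (fun j => cst (grid R n j))) => //.
  - by move=> j; exact: ptc_measurable_cell H.
  - by move=> w; eexists; apply: grid_cell_truncn; exact: ptc_time_ge0 H _.
  - by move=> j w /= /grid_cellP jw; rewrite /grid_above jw.
have S0 := ptc_time_ge0 H.
have h1 : (fun n => Rintegral P setT (\1_[set w | N (grid_above n (S w)) w = k%:R] : T -> R))
    @ \oo --> Rintegral P setT (\1_[set w | N (S w) w = k%:R] : T -> R).
  apply: (@bounded_cvg_Rintegral _ _ _ _ _ _ 1) => //.
  - by move=> n x; rewrite indicE; case: (_ \in _); rewrite ?normr1 ?normr0.
  - have : {ae P, forall w, forall n j, exists i, N (grid R n j) w = i%:R}.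
      apply: ae_foralln => n; apply: ae_foralln => j.
      exact: ptc_natural H (grid_gt0 R n j).
    apply: filterS => w nat_w; have XnX := @ptc_above_cvg _ _ _ _ _ _ _ w H.
    pose X n := N (grid_above n (S w)) w.
    (* within distance e of the limit, being equal to k is decided by the limit *)
    pose e : R := if N (S w) w == k%:R then 1 else `|N (S w) w - k%:R|.
    have e0 : 0 < e by rewrite /e; case: ifPn => // ne; rewrite normr_gt0 subr_eq0.
    apply: cvg_near_cst; move/cvgrPdist_lt : XnX => /(_ _ e0).
    apply: filterS => n; rewrite !indicE => XX; congr ((nat_of_bool _)%:R).
    apply/idP/idP; rewrite !inE /= => Xk.
      apply/eqP/negPn/negP => ne; move: XX; rewrite /e (negbTE ne).
      by rewrite Xk ltxx.
    have [i Xi] := nat_w n (Num.truncn (n.+1%:R * S w)).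
    move: XX; rewrite /e Xk eqxx -/(grid_above _ _) /grid_above Xi.
    rewrite ltNge => /negP XX; apply/eqP/negPn/negP => ik; apply: XX.
    apply: norm_intr_ge1; first by rewrite rpredB// natr_int.
    by rewrite subr_eq0 eq_sym.
have h2 : (fun n => Rintegral P setT (fun w => pois k (lambda * grid_above n (S w))))
    @ \oo --> Rintegral P setT (fun w => pois k (lambda * S w)).
  apply: (@bounded_cvg_Rintegral _ _ _ _ _ _ 1) => //.
  - by move=> n; exact: mpois.
  - by apply: mpois; exact: ptc_measurable_time H.
  - move=> n w; have y0 : 0 <= lambda * grid_above n (S w).
      by rewrite mulr_ge0 ?(ltW l0)// ltW// grid_gt0.
    by rewrite ger0_norm ?pois_ge0// pois_le1.
  - apply: aeW => w; apply: cvgn_comp; first exact: continuous_pois.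
    by apply: cvgn_scale; exact: grid_above_cvg.
rewrite -Rintegral_indic//.
apply: (cvg_unique _ h1) => //.
apply: (cvgn_ext _ h2) => n.
by rewrite Rintegral_indic// (ptc_above_law n k l0 H).
Qed.

(** Given S, the variable N S is Poisson with parameter lambda S, and
    E z^(N S) = exp (- lambda S (1 - z)). *)
Lemma ptc_gen (d : measure_display) (T : measurableType d)
    (R : realType) (P : probability T R) (lambda z : R) (N : R -> T -> R)
    (S : T -> R) :
  0 < lambda -> poisson_time_change P lambda N S -> 0 <= z <= 1 ->
  series (fun k => fine (P [set w | N (S w) w = k%:R]) * z ^+ k) @ \oo -->
  Rintegral P setT (fun w => expR (- (lambda * (1 - z)) * S w)).
Proof.
move=> l0 H /andP[z0 z1]; have S0 := ptc_time_ge0 H.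
have y0 w : 0 <= lambda * S w by rewrite mulr_ge0// ltW.
have mS : measurable_fun setT (fun w => lambda * S w).
  by apply: measurable_funM => //; exact: ptc_measurable_time H.
have mp k : measurable_fun setT (fun w => pois k (lambda * S w)).
  apply: measurableT_comp => //.
  exact: continuous_measurable_fun (@continuous_pois R k).
have P1 : (P setT < +oo)%E by rewrite probability_setT ltry.
have ip k : P.-integrable setT (EFin \o (fun w => pois k (lambda * S w))).
  apply: measurable_bounded_integrable => //.
  exists 1; split => // M M1 w _ /=.
  by rewrite ger0_norm ?pois_ge0// (le_trans (pois_le1 _ _))// ltW.
apply: cvg_series_EFin => [k|].
  by rewrite mulr_ge0 ?exprn_ge0// fine_ge0.
transitivity (\sum_(k <oo) \int[P]_w (pois k (lambda * S w) * z ^+ k)%:E)%E.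
  apply: eq_eseriesr => k _; rewrite (ptc_law k l0 H) -RintegralZr//.
  rewrite /Rintegral fineK// integrable_fin_num//.
  have := integrableZr measurableT (z ^+ k) (ip k).
  by congr (integrable _ _ _).
rewrite -integral_nneseries//; last 2 first.
- by move=> k; apply/measurable_EFinP; apply: measurable_funM.
- by move=> k w _; rewrite lee_fin mulr_ge0 ?pois_ge0 ?exprn_ge0.
rewrite (eq_integral (fun w => (expR (- (lambda * (1 - z)) * S w))%:E)); last first.
  move=> w _; rewrite (eseries_EFin (@pois_gen R (lambda * S w) z)).
  by congr (expR _)%:E; ring.
rewrite /Rintegral fineK// integrable_fin_num//.
apply: measurable_bounded_integrable => //.
  apply: measurableT_comp => //; apply: measurable_funM => //; exact: ptc_measurable_time H.
exists 1; split => // M M1 w _ /=; rewrite ger0_norm ?expR_ge0//.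
apply: le_trans (ltW M1); rewrite -[leRHS]expR0 ler_expR mulNr oppr_le0.
by rewrite mulr_ge0// mulr_ge0 ?subr_ge0// ltW.
Qed.

(** The generating function at z = 1 shows that the probabilities of the natural
    values add up to 1, so that these values carry the whole law. *)
Lemma ptc_integral (d : measure_display) (T : measurableType d)
    (R : realType) (P : probability T R) (lambda C : R) (N : R -> T -> R)
    (S : T -> R) (f : R -> R) :
  0 < lambda -> poisson_time_change P lambda N S ->
  measurable_fun setT f -> (forall x, `|f x| <= C) ->
  series (fun k => fine (P [set w | N (S w) w = k%:R]) * f k%:R) @ \oo -->
  Rintegral P setT (fun w => f (N (S w) w)).
Proof.
move=> l0 H mf fC; pose E k := [set w | N (S w) w = k%:R].
have mX := ptc_measurable_subordinated H.
have mE k : measurable (E k) by exact: measurable_event_eq.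
have tE : trivIset setT E by exact: trivIset_nat_fibers.
have PE k : P (E k) = (fine (P (E k)))%:E by rewrite fineK// fin_num_measure.
have p1 : series (fun k => fine (P (E k))) @ \oo --> (1 : R).
  have := @ptc_gen _ _ _ _ _ 1 _ _ l0 H; rewrite ler01 lexx => /(_ isT) h.
  have e : Rintegral P setT (fun w => expR (- (lambda * (1 - 1)) * S w)) = 1.
    rewrite (_ : (fun w => _) = cst 1).
      transitivity (1 * fine (P setT)); first exact: Rintegral_cst.
      by rewrite probability_setT mulr1.
    by apply/funext => w; rewrite subrr mulr0 oppr0 mul0r expR0.
  rewrite e in h; apply: (cvgn_ext _ h) => n; congr series; apply/funext => k.
  by rewrite expr1n mulr1.
have PU : P (~` \bigcup_k E k) = 0%E.
  rewrite probability_setC; last exact: bigcupT_measurable.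
  rewrite measure_semi_bigcup//; last exact: bigcupT_measurable.
  by rewrite (eq_eseriesr (fun k _ => PE k)) (eseries_EFin p1) subee.
have sum : cvgn (series (fun k => fine (P (E k)) * `|f k%:R|)).
  apply: (series_le_cvg _ _ _ (cvgP _ (cvg_series_scale C p1))) => k.
  - by rewrite mulr_ge0 ?fine_ge0.
  - by rewrite mulr_ge0 ?fine_ge0// (le_trans _ (fC 0)).
  - by rewrite [leRHS]mulrC ler_wpM2l ?fine_ge0.
exact: (@integral_partition _ _ _ P E (fun k => fine (P (E k)))
  (fun k => f k%:R) (fun w => f (N (S w) w)) mE tE PU PE
  (measurableT_comp mf mX) (fun k w e => congr1 f e) sum).2.
Qed.

(** * The masses of the Levy measure *)

(** The coefficient of z^l in (mu + lambda)^alpha - (mu + lambda - lambda z)^alpha. *)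
Definition levy_mass (R : realType) (lambda alpha mu : R) (l : nat) : R :=
  if l is 0%N then 0 else
  - ((mu + lambda) `^ alpha * (gbinom alpha l * (- (lambda / (mu + lambda))) ^+ l)).

(** All factors alpha - i with i >= 1 are negative. *)
Lemma gbinom_sign (R : realType) (alpha : R) l : 0 < alpha < 1 ->
  0 <= (-1) ^+ l * gbinom alpha l.+1.
Proof.
move=> /andP[a0 a1]; elim: l => [|l ih].
  by rewrite gbinomS gbinom0 expr0 !mul1r subr0 divr1 ltW.
rewrite gbinomS exprS; set g := gbinom _ _ in ih *.
rewrite (_ : _ * _ = ((-1) ^+ l * g) * ((l.+1%:R - alpha) / l.+2%:R)); last by ring.
rewrite mulr_ge0// divr_ge0// subr_ge0 (le_trans (ltW a1))//.
by rewrite -natr1 lerDr.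
Qed.

Lemma levy_mass_ge0 (R : realType) (lambda alpha mu : R) l :
  0 < lambda -> 0 < alpha < 1 -> 0 < mu -> 0 <= levy_mass lambda alpha mu l.
Proof.
move=> l0 a01 m0; case: l => [|l] //=.
rewrite -mulrN mulr_ge0 ?powR_ge0// exprNn exprS.
set q := lambda / _; set g := gbinom _ _.
rewrite (_ : - _ = ((-1) ^+ l * g) * q ^+ l.+1); last by ring.
rewrite mulr_ge0 ?gbinom_sign// exprn_ge0// divr_ge0 ?ltW//.
by rewrite addr_gt0.
Qed.

Lemma powR_scale (R : realType) (a x b : R) : 0 < a -> 0 <= 1 + x ->
  a `^ b * (1 + x) `^ b = (a + a * x) `^ b.
Proof. by move=> a0 x0; rewrite -powRM ?(ltW a0)// mulrDr mulr1. Qed.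

Lemma levy_mass_gen (R : realType) (lambda alpha mu z : R) :
  0 < lambda -> 0 < mu -> 0 <= z <= 1 ->
  series (fun l => levy_mass lambda alpha mu l * z ^+ l) @ \oo -->
  (mu + lambda) `^ alpha - (mu + lambda * (1 - z)) `^ alpha.
Proof.
move=> l0 m0 /andP[z0 z1]; have a0 : 0 < mu + lambda by rewrite addr_gt0.
pose x := - (lambda / (mu + lambda) * z).
have q1 : lambda / (mu + lambda) < 1 by rewrite ltr_pdivrMr// mul1r ltrDr.
have q0 : 0 <= lambda / (mu + lambda) by rewrite divr_ge0 ?ltW.
have qz1 : lambda / (mu + lambda) * z < 1.
  by apply: le_lt_trans q1; rewrite ler_piMr.
have x1 : `|x| < 1 by rewrite normrN ger0_norm// mulr_ge0.
have h := cvgn_scale ((mu + lambda) `^ alpha) (@binomial_series _ alpha _ x1).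
rewrite powR_scale ?subr_ge0 ?(ltW qz1)// in h.
have e : mu + lambda + (mu + lambda) * x = mu + lambda * (1 - z).
  by rewrite /x; field; rewrite gt_eqF.
rewrite e in h; rewrite -cvg_shiftS.
have h2 : (fun n => (mu + lambda) `^ alpha - (mu + lambda) `^ alpha *
    pseries (gbinom alpha) x n.+1) @ \oo -->
    (mu + lambda) `^ alpha - (mu + lambda * (1 - z)) `^ alpha.
  by apply: cvgB; [exact: cvg_cst|rewrite -cvg_shiftS in h].
apply: (cvgn_ext _ h2) => n.
rewrite /pseries/series/= !big_nat_recl//= gbinom0 !expr0 !mulr1 ?mul0r add0r.
rewrite mulrDr mulr1 opprD addrA subrr add0r mulr_sumr -sumrN.
apply: eq_bigr => i _.
have -> : x = - (lambda / (mu + lambda)) * z by rewrite mulNr.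
by rewrite exprMn mulNr !mulrA.
Qed.

Definition levy_coef (R : realType) (lambda alpha mu : R) (n : nat) : R :=
  mu `^ (alpha - n%:R) * gbinom alpha n * lambda ^+ n.

Lemma powR_subn (R : realType) (a b : R) n : 0 < a ->
  a `^ (b - n%:R) = a `^ b / a ^+ n.
Proof.
move=> a0; rewrite powRD; last by rewrite (gt_eqF a0) implybT.
by rewrite powRN powR_mulrn// ltW.
Qed.

(** The factorial moments are [binomial_series_bin] at - lambda / (mu + lambda). *)
Lemma levy_mass_moment (R : realType) (lambda alpha mu : R) j :
  0 < lambda -> 0 < mu -> (0 < j)%N ->
  series (fun l => levy_mass lambda alpha mu l * 'C(l, j)%:R) @ \oo -->
  (-1) ^+ j.+1 * levy_coef lambda alpha mu j.
Proof.
move=> l0 m0 j0; have a0 : 0 < mu + lambda by rewrite addr_gt0.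
pose q := lambda / (mu + lambda).
have q1 : q < 1 by rewrite ltr_pdivrMr// mul1r ltrDr.
have q0 : 0 <= q by rewrite divr_ge0 ?ltW.
have x1 : `|- q| < 1 by rewrite normrN ger0_norm.
have h := cvg_series_scale (- (mu + lambda) `^ alpha) (@binomial_series_bin _ alpha _ j x1).
have -> : (-1) ^+ j.+1 * levy_coef lambda alpha mu j =
    - (mu + lambda) `^ alpha * (gbinom alpha j * (- q) ^+ j * (1 - q) `^ (alpha - j%:R)).
  have e : (mu + lambda) `^ alpha * (1 - q) `^ alpha = mu `^ alpha.
    rewrite powR_scale ?subr_ge0 ?(ltW q1)//; congr (_ `^ _).
    by rewrite /q; field; rewrite gt_eqF.
  rewrite /levy_coef !powR_subn ?subr_gt0// -e.
  have -> : 1 - q = mu / (mu + lambda) by rewrite /q; field; rewrite gt_eqF.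
rewrite [(- q) ^+ j]exprNn exprS /q !expr_div_n.
  by field; rewrite !expf_neq0// ?gt_eqF.
apply: (cvgn_ext _ h) => n; congr series; apply/funext => -[|l] /=.
  by rewrite bin0n; case: j j0 {h} => //= j _; rewrite !mul0r mulr0.
by rewrite -/q; ring.
Qed.

(** Every term of the density of index n >= l contributes to the atom at l; the
    sum of these contributions is [binomial_series_bin] at lambda / mu. *)
Lemma levy_mass_series (R : realType) (lambda alpha mu : R) l :
  0 < lambda -> lambda < mu -> (0 < l)%N ->
  series (fun n => levy_coef lambda alpha mu n * 'C(n, l)%:R) @ \oo -->
  (-1) ^+ l.+1 * levy_mass lambda alpha mu l.
Proof.
move=> l0 lm l1; have m0 : 0 < mu by exact: lt_trans lm.
pose r := lambda / mu.
have r1 : `|r| < 1 by rewrite ger0_norm ?divr_ge0 ?ltW// ltr_pdivrMr// mul1r.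
have r0 : 0 < r by rewrite divr_gt0.
have a0 : 0 < mu + lambda by rewrite addr_gt0.
have h := cvg_series_scale (mu `^ alpha) (@binomial_series_bin _ alpha _ l r1).
have -> : (-1) ^+ l.+1 * levy_mass lambda alpha mu l =
    mu `^ alpha * (gbinom alpha l * r ^+ l * (1 + r) `^ (alpha - l%:R)).
  have e : mu `^ alpha * (1 + r) `^ alpha = (mu + lambda) `^ alpha.
    by rewrite powR_scale ?addr_ge0 ?(ltW r0)//; congr (_ `^ _); rewrite /r; field; rewrite gt_eqF.
  rewrite /levy_mass; case: l l1 {h} => // l _.
  rewrite powR_subn ?addr_gt0// -e.
  have -> : 1 + r = (mu + lambda) / mu by rewrite /r; field; rewrite gt_eqF.
  rewrite [(- (lambda / _)) ^+ _]exprNn !expr_div_n exprS; set s := (-1) ^+ l.+1.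
  have ss : s * s = 1 by rewrite -expr2 sqrr_sign.
  transitivity (s * s * (mu `^ alpha * ((mu + lambda) / mu) `^ alpha * (gbinom alpha l.+1 * (lambda ^+ l.+1 / (mu + lambda) ^+ l.+1)))).
    by ring.
  rewrite ss.
  by field; rewrite !expf_neq0// ?gt_eqF.
apply: (cvgn_ext _ h) => n; congr series; apply/funext => k /=.
rewrite /levy_coef powR_subn// /r expr_div_n; ring.
Qed.

(** * The terms of the density against binomials *)

(** Binomial inversion, by Pascal's rule in n. *)
Lemma sum_bin_bin_sign (R : realType) (n j : nat) :
  \sum_(0 <= l < n.+1) ('C(n, l)%:R * (-1) ^+ l * 'C(l, j)%:R : R) =
  (-1) ^+ j * (n == j)%:R.
Proof.
elim: n j => [|n ih] j.
  by rewrite big_nat1 bin0 expr0 !mul1r bin0n eq_sym; case: j => [|j]; rewrite ?mulr0 ?mulr1.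
have step : \sum_(0 <= l < n.+2) ('C(n.+1, l)%:R * (-1) ^+ l * 'C(l, j)%:R : R) =
    \sum_(0 <= l < n.+1) ('C(n, l)%:R * (-1) ^+ l * 'C(l, j)%:R : R) -
    \sum_(0 <= l < n.+1) ('C(n, l)%:R * (-1) ^+ l * 'C(l.+1, j)%:R : R).
  rewrite big_nat_recl// bin0 [X in _ = X - _]big_nat_recl// bin0 -addrA; congr (_ + _).
  under eq_bigr do rewrite binS natrD !mulrDl.
  rewrite big_split/= [X in X + _]big_nat_recr//= bin_small// !mul0r addr0; congr (_ + _).
  rewrite -sumrN; apply: eq_bigr => l _; rewrite exprS; ring.
rewrite step; case: j {step} => [|j].
  under [X in _ - X]eq_bigr do rewrite bin0.
  under [X in X - _]eq_bigr do rewrite bin0.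
  by rewrite subrr mulr0.
under [X in _ - X]eq_bigr do rewrite binS natrD mulrDr.
by rewrite big_split/= !ih opprD addrA subrr add0r eqSS exprS !mulNr mul1r.
Qed.

(** By binomial inversion the n-th term of the density pairs to 0 with C(x, j)
    unless n = j.  The condition a 0 = 0 is needed because the atom l = 0 is left
    out of the inner sum. *)
Lemma levy_term_binomial (R : realType) (lambda alpha mu : R) n (f : R -> R)
    (a : nat -> R) (d : nat) :
  (forall l, f l%:R = \sum_(0 <= j < d) a j * 'C(l, j)%:R) -> a 0%N = 0 ->
  levy_term lambda alpha mu n f =
  \sum_(0 <= j < d) a j * ((-1) ^+ j.+1 * levy_coef lambda alpha mu j) * (n == j)%:R.
Proof.
move=> fE a0; rewrite /levy_term -/(levy_coef lambda alpha mu n).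
have -> : \sum_(1 <= l < n.+1) 'C(n, l)%:R * (-1) ^+ l.+1 * f l%:R =
    \sum_(0 <= j < d) a j * - \sum_(1 <= l < n.+1) 'C(n, l)%:R * (-1) ^+ l * 'C(l, j)%:R.
  under eq_bigr do rewrite fE mulr_sumr.
  rewrite exchange_big/=; apply: eq_bigr => j _.
  rewrite -sumrN mulr_sumr; apply: eq_bigr => l _; rewrite exprS; ring.
rewrite mulr_sumr; apply: eq_bigr => -[|j] _; first by rewrite a0 !mul0r mulr0.
have := sum_bin_bin_sign R n j.+1; rewrite big_ltn// mulr0 add0r => ->.
have [->|nj] := eqVneq n j.+1; last by rewrite !mulr0 oppr0 !mulr0.
by rewrite exprS [(-1) ^+ j.+2]exprS exprS; ring.
Qed.

Lemma poly_binomial_basis (R : realType) (p : {poly R}) :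
  exists (a : nat -> R) (d : nat),
    forall l : nat, p.[l%:R] = \sum_(0 <= j < d) a j * 'C(l, j)%:R.
Proof.
elim/poly_ind: p => [|p c [a [d pE]]].
  by exists (fun=> 0), 0%N => l; rewrite horner0 big_nil.
(* l C(l, j) = j C(l, j) + (j + 1) C(l, j + 1) *)
exists (fun j => (if (j < d)%N then j%:R * a j else 0) +
          (if j is i.+1 then j%:R * a i else c)), d.+1 => l.
rewrite hornerMXaddC pE.
under [RHS]eq_bigr do rewrite mulrDl.
rewrite big_split/= big_nat_recr//= ltnn mul0r addr0.
rewrite [X in _ = _ + X]big_nat_recl//= bin0 mulr1 [c + _]addrC addrA; congr (_ + c).
rewrite mulr_suml -big_split/=; apply: eq_big_nat => j /andP[_ jd]; rewrite jd.
have e : 'C(l, j)%:R * l%:R = j%:R * 'C(l, j)%:R + j.+1%:R * 'C(l, j.+1)%:R :> R.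
  rewrite -!natrM -natrD; congr (_%:R).
  rewrite mul_bin_left -mulnDl mulnC.
  have [lj|jl] := ltnP l j; first by rewrite bin_small// !muln0.
  by rewrite subnKC.
by rewrite -[LHS]mulrA e; ring.
Qed.

(** * Existence of the Levy measure *)

Lemma cexp_iE (R : realType) (y : R) :
  cexp (0 +i* y)%C = complex.Complex (cos y) (sin y).
Proof. by rewrite /cexp /= expR0 !mul1r. Qed.

Lemma cexp_realM (R : realType) (t x y : R) :
  cexp (t%:C * (x +i* y))%C =
  complex.Complex (expR (t * x) * cos (t * y)) (expR (t * x) * sin (t * y)).
Proof. by rewrite /cexp /= !mul0r subr0 addr0. Qed.

Lemma cintegral_cexp (d : measure_display) (T : measurableType d)
    (R : realType) (m : {measure set T -> \bar R}) (f : T -> R) :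
  cintegral m (fun w => cexp (0 +i* f w)%C) =
  complex.Complex (Rintegral m setT (fun w => cos (f w)))
                  (Rintegral m setT (fun w => sin (f w))).
Proof.
by congr complex.Complex; congr (Rintegral _ _ _); apply/funext => w; rewrite cexp_iE.
Qed.

Lemma cintegral_cexpB1 (d : measure_display) (T : measurableType d)
    (R : realType) (m : {measure set T -> \bar R}) (f : T -> R) :
  cintegral m (fun w => cexp (0 +i* f w)%C - 1) =
  complex.Complex (Rintegral m setT (fun w => cos (f w) - 1))
                  (Rintegral m setT (fun w => sin (f w))).
Proof.
congr complex.Complex; congr (Rintegral _ _ _); apply/funext => w;
by rewrite cexp_iE /= ?subr0.
Qed.

Lemma cintegrable_cexpB1 (d : measure_display) (T : measurableType d)
    (R : realType) (m : {measure set T -> \bar R}) (f : T -> R) :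
  cintegrable m (fun w => cexp (0 +i* f w)%C - 1) <->
  m.-integrable setT (EFin \o (fun w => cos (f w) - 1)) /\
  m.-integrable setT (EFin \o (fun w => sin (f w))).
Proof.
rewrite /cintegrable.
have -> : (fun w => (complex.Re (cexp (0 +i* f w)%C - 1))%:E) =
    EFin \o (fun w => cos (f w) - 1) by apply/funext => w; rewrite cexp_iE.
have -> : (fun w => (complex.Im (cexp (0 +i* f w)%C - 1))%:E) =
    EFin \o (fun w => sin (f w)) by apply/funext => w; rewrite cexp_iE /= subr0.
by [].
Qed.

Lemma nat_carried_integral (R : realType)
    (nu : {measure set (measurableTypeR R) -> \bar R}) (c : nat -> R) (f : R -> R) :
  nu (~` [set x | exists k : nat, x = k%:R]) = 0%E ->
  (forall k, nu [set k%:R] = (c k)%:E) -> measurable_fun setT f ->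
  cvgn (series (fun k => c k * `|f k%:R|)) ->
  nu.-integrable setT (EFin \o f) /\
  series (fun k => c k * f k%:R) @ \oo --> Rintegral nu setT f.
Proof.
move=> nuN nuc mf sf; pose E (k : nat) : set (measurableTypeR R) := [set k%:R].
have tE : trivIset setT E.
  apply/trivIsetP => i j _ _ ij; apply/seteqP; split => w //= [-> /eqP].
  by rewrite eqr_nat (negbTE ij).
have nuE : nu (~` \bigcup_k E k) = 0%E.
  rewrite -nuN; congr (nu (~` _)); apply/seteqP; split => x /=.
    by move=> [k _ ->]; exists k.
  by move=> [k ->]; exists k.
have mE k : measurable (E k) by exact: measurable_set1.
exact: (@integral_partition _ _ _ nu E c (fun k => f k%:R) f mE tE nuE nuc mf
  (fun k x e => congr1 f e) sf).
Qed.

Lemma atomic_measure_exists (R : realType) (c : nat -> R) :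
  (forall k, 0 <= c k) ->
  exists nu : {measure set (measurableTypeR R) -> \bar R},
    nu (~` [set x | exists k : nat, x = k%:R]) = 0%E /\
    (forall k : nat, nu [set k%:R] = (c k)%:E).
Proof.
move=> c0; pose m (k : nat) : {measure set (measurableTypeR R) -> \bar R} :=
  mscale (NngNum (c0 k)) (@dirac _ (measurableTypeR R) k%:R R).
have mE k A : m k A = (c k * \1_A (k%:R : R))%:E.
  by rewrite /m /= /mscale/= diracE indicE EFinM.
exists (mseries m 0); split.
  rewrite /= /mseries; apply: eseries0 => k _ _.
  rewrite mE indicE memNset ?mulr0//= => h; apply: h.
  by exists k.
move=> k; rewrite /= /mseries (eq_eseriesr (fun j _ => mE j [set k%:R])).
rewrite (@eseries_EFin _ _ (c k))//.
apply: (@cvg_near_cst) => //; near=> n.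
have kn : (k < n)%N by near: n; exact: nbhs_infty_gt.
rewrite /series/= (bigD1_seq k) ?mem_index_iota ?iota_uniq//= big1 => [|j jk].
  by rewrite indicE mem_set// mulr1 addr0.
rewrite indicE memNset ?mulr0//= => /eqP; rewrite eqr_nat; exact/negP.
Unshelve. all: end_near. Qed.

Lemma cvg_levy_mass (R : realType) (lambda alpha mu : R) :
  0 < lambda -> 0 < mu ->
  series (levy_mass lambda alpha mu) @ \oo --> (mu + lambda) `^ alpha - mu `^ alpha.
Proof.
move=> l0 m0; have := @levy_mass_gen _ _ alpha _ 1 l0 m0.
rewrite ler01 lexx subrr mulr0 addr0 => /(_ isT) h.
by apply: (cvgn_ext _ h) => n; congr series; apply/funext => k; rewrite expr1n mulr1.
Qed.

(** The Laplace transform of D at lambda (1 - z) turns [ptc_gen] into the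
    hypothesis of [compound_poisson_cf], with C1 the total mass of nu. *)
Lemma levy_measure_of_masses (d : measure_display) (T : measurableType d)
    (R : realType) (P : probability T R) (lambda alpha mu : R)
    (N D : R -> T -> R) (nu : {measure set (measurableTypeR R) -> \bar R}) :
  0 < lambda -> 0 < alpha < 1 -> 0 < mu ->
  (forall t, 0 <= t -> poisson_time_change P lambda N (D t)) ->
  (forall s t, 0 < s -> 0 <= t -> Rintegral P setT (fun w => expR (- s * D t w)) =
      expR (- t * ((s + mu) `^ alpha - mu `^ alpha))) ->
  nu (~` [set x | exists k : nat, x = k%:R]) = 0%E ->
  (forall k : nat, nu [set k%:R] = (levy_mass lambda alpha mu k)%:E) ->
  levy_measure P (subordinated N D) nu.
Proof.
move=> l0 a01 m0 ptc lap nuN nuc.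
pose c := levy_mass lambda alpha mu.
have c0 k : 0 <= c k by exact: levy_mass_ge0.
have cs := @cvg_levy_mass _ _ alpha _ l0 m0.
have bnd (f : R -> R) C : measurable_fun setT f -> (forall x, `|f x| <= C) ->
    nu.-integrable setT (EFin \o f) /\
    series (fun k => c k * f k%:R) @ \oo --> Rintegral nu setT f.
  move=> mf fC; apply: nat_carried_integral => //.
  apply: (series_le_cvg _ _ _ (cvgP _ (cvg_series_scale C cs))) => k.
  - by rewrite mulr_ge0.
  - by rewrite mulr_ge0// (le_trans _ (fC 0)).
  - by rewrite [leRHS]mulrC ler_wpM2l.
have cos1 (x : R) : `|cos x| <= 1 by rewrite ler_norml cos_geN1 cos_le1.
have sin1 (x : R) : `|sin x| <= 1 by rewrite ler_norml sin_geN1 sin_le1.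
have mcos th : measurable_fun setT (fun x : R => cos (th * x)).
  exact: continuous_measurable_fun (@continuous_cosM R th).
have msin th : measurable_fun setT (fun x : R => sin (th * x)).
  exact: continuous_measurable_fun (@continuous_sinM R th).
have icos th := bnd (fun x : R => cos (th * x)) 1 (mcos th) (fun x => cos1 _).
have isin th := bnd (fun x : R => sin (th * x)) 1 (msin th) (fun x => sin1 _).
have n1 (x : R) : `|cst 1 x : R| <= 1 by rewrite normr1.
have [i1 h1] := bnd (cst 1) 1 (measurable_cst _) n1.
pose C1 := (mu + lambda) `^ alpha - mu `^ alpha.
have I1 : Rintegral nu setT (cst 1) = C1.
  apply: (cvg_unique _ h1) => //.
  by apply: (cvgn_ext _ cs) => n; congr series; apply/funext => k; rewrite mulr1.
split.
- by have := nuc 0%N.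
- have mmin : measurable_fun setT (fun x : R => Num.min 1 (x ^+ 2)).
    by apply: measurable_minr => //; exact: measurable_funX.
  have bmin (x : R) : `|Num.min 1 (x ^+ 2)| <= 1.
    by rewrite ger0_norm ?ge_min ?lexx// le_min ler01 sqr_ge0.
  exact: integrable_lty (bnd _ _ mmin bmin).1.
- move=> theta; apply/cintegrable_cexpB1; split; last exact: (isin theta).1.
  exact: (integrableB measurableT (icos theta).1 i1).
move=> theta t t0; rewrite cintegral_cexp cintegral_cexpB1 cexp_realM.
have -> : Rintegral nu setT (fun x : R => cos (theta * x) - 1) =
    Rintegral nu setT (fun x : R => cos (theta * x)) - C1.
  by rewrite RintegralB ?I1//; exact: (icos theta).1.
have Ht := ptc t t0.
pose p k := fine (P [set w | N (D t w) w = k%:R]).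
have pg := fun z => @ptc_gen _ _ _ _ _ z _ _ l0 Ht.
have pcf := @compound_poisson_cf R p c t C1 theta _ _ _ c0 _ _ (cvgP _ cs) _
   (icos theta).2 (isin theta).2.
have [||||hc hs] := pcf.
- by move=> k; rewrite fine_ge0.
- by [].
- have := pg 1; rewrite ler01 lexx => /(_ isT) h.
  apply: (cvgP _ (cvgn_ext _ h)) => n; congr series; apply/funext => k.
  by rewrite expr1n mulr1.
- move=> z /andP[z0 z1]; have z01 : 0 <= z <= 1 by rewrite z0 ltW.
  have -> : psum c z = (mu + lambda) `^ alpha - (mu + lambda * (1 - z)) `^ alpha.
    by apply/cvg_lim => //; exact: levy_mass_gen.
  have -> : psum p z = Rintegral P setT (fun w => expR (- (lambda * (1 - z)) * D t w)).
    by apply/cvg_lim => //; exact: pg.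
  rewrite lap// ?mulr_gt0 ?subr_gt0//; congr expR.
  by rewrite [lambda * _ + mu]addrC /C1; ring.
congr complex.Complex.
  apply: (cvg_unique _ _ hc) => //.
  exact: (@ptc_integral _ _ _ _ _ 1 _ _ (fun x => cos (theta * x)) l0 Ht).
apply: (cvg_unique _ _ hs) => //.
exact: (@ptc_integral _ _ _ _ _ 1 _ _ (fun x => sin (theta * x)) l0 Ht).
Qed.

(** * Uniqueness of the Levy measure *)

(** The exponential is not injective, but it is along whole half-lines: moduli
    give x = x', and y <> y' is refuted at t = pi / |y - y'|. *)
Lemma cexp_line_inj (R : realType) (x y x' y' : R) :
  (forall t, 0 <= t -> cexp (t%:C * (x +i* y))%C =
                       cexp (t%:C * (x' +i* y'))%C) -> x = x' /\ y = y'.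
Proof.
move=> h.
have hc t : 0 <= t -> expR (t * x) * cos (t * y) = expR (t * x') * cos (t * y') /\
    expR (t * x) * sin (t * y) = expR (t * x') * sin (t * y').
  by move=> /h; rewrite !cexp_realM => -[].
have mod (t u v : R) : (expR (t * u) * cos (t * v)) ^+ 2 + (expR (t * u) * sin (t * v)) ^+ 2 =
    expR (t * u) ^+ 2 by rewrite !exprMn -mulrDr cos2Dsin2 mulr1.
have xx : x = x'.
  have [c1 s1] := hc 1 ler01.
  have := mod 1 x y; rewrite c1 s1 mod !mul1r => /eqP.
  by rewrite eqrXn2 ?expR_ge0// => /eqP /expR_inj.
split => //; subst x'; apply/eqP; rewrite -subr_eq0; apply/negPn/negP => d0.
pose t := pi / `|y - y'|.
have n0 : 0 < `|y - y'| by rewrite normr_gt0.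
have t0 : 0 <= t by rewrite divr_ge0 ?pi_ge0.
have [c1 s1] := hc t t0.
have e0 : expR (t * x) != 0 by rewrite gt_eqF ?expR_gt0.
have {}c1 := mulfI e0 c1; have {}s1 := mulfI e0 s1.
have c2 : cos (t * (y - y')) = 1.
  by rewrite mulrBr cosB c1 s1 -!expr2 cos2Dsin2.
have : cos (t * `|y - y'|) = 1.
  by case: (ger0P (y - y')) => // _; rewrite mulrN cosN.
rewrite /t divfK ?gt_eqF// cospi => e; lra.
Qed.

(** Near 0 the lattice has only the origin, which is not charged, and away from
    0 a Levy measure is finite. *)
Lemma levy_measure_finite_lattice (d : measure_display) (T : measurableType d)
    (R : realType) (P : probability T R) (X : R -> T -> R)
    (nu : {measure set (measurableTypeR R) -> \bar R}) :
  levy_measure P X nu -> nu (~` [set x : R | x \is a Num.int]) = 0%E ->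
  (nu setT < +oo)%E.
Proof.
move=> H nuZ; pose A : set (measurableTypeR R) := [set x : R | 1 <= `|x|].
have mA : measurable A.
  rewrite -[A]setTI; have := continuous_measurable_fun (@norm_continuous R R).
  rewrite (_ : A = (fun x : R => `|x|) @^-1` `[1, +oo[%classic); last first.
    by apply/seteqP; split => x /=; rewrite in_itv/= andbT.
  by apply => //; exact: measurable_itv.
have mZ := @measurable_int_set R.
pose O : set (measurableTypeR R) := [set 0].
pose Zc : set (measurableTypeR R) := ~` [set x : R | x \is a Num.int].
have mO : measurable O by exact: measurable_set1.
have mZc : measurable Zc by exact: measurableC.
have nuA : (nu A < +oo)%E.
  apply: le_lt_trans (levy_measure_finite H).
  pose f (x : R) : \bar R := (Num.min 1 (x ^+ 2))%:E.
  have mf : measurable_fun setT f.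
    apply/measurable_EFinP; apply: measurable_minr => //; exact: measurable_funX.
  have f0 x : (0 <= f x)%E by rewrite lee_fin le_min ler01 sqr_ge0.
  apply: (@le_trans _ _ (\int[nu]_(x in A) f x)%E); last exact: ge0_subset_integral.
  rewrite (eq_integral (cst 1%E)) ?integral_cst ?mul1e// => x; rewrite inE /A /= => x1.
  by rewrite /f min_l// -real_normK ?num_real// expr_ge1.
have sub : setT `<=` A `|` (Zc `|` O).
  move=> x _; have [xi|xi] := boolP ((x : R) \is a Num.int); last first.
    by right; left; exact/negP.
  have [->|x0] := eqVneq (x : R) 0; first by right; right.
  by left; exact: norm_intr_ge1.
have mU : measurable (Zc `|` O) by exact: measurableU.
apply: (@le_lt_trans _ _ (nu A + (nu Zc + nu O))%E).
  apply: (@le_trans _ _ (nu (A `|` (Zc `|` O)))).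
    by apply: le_measure => //; rewrite inE//; exact: measurableU.
  apply: (@le_trans _ _ (nu A + nu (Zc `|` O))%E); first exact: measureU2.
  by rewrite leeD2l//; exact: measureU2.
by rewrite [nu Zc]nuZ [nu O](levy_measure_origin H) !adde0.
Qed.

(** Both measures have the same exponent by [cexp_line_inj].  At theta = 2 pi it
    forces nu onto the integers as well. *)
Lemma levy_measure_lattice_unique (d : measure_display) (T : measurableType d)
    (R : realType) (P : probability T R) (X : R -> T -> R)
    (nu nu' : {measure set (measurableTypeR R) -> \bar R}) :
  levy_measure P X nu -> levy_measure P X nu' ->
  nu' (~` [set x : R | x \is a Num.int]) = 0%E ->
  nu (~` [set x : R | x \is a Num.int]) = 0%E /\
  (forall k : R, k \is a Num.int -> nu [set k] = nu' [set k]).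
Proof.
move=> H H' nuZ'.
have E th : Rintegral nu setT (fun x : R => cos (th * x) - 1) =
      Rintegral nu' setT (fun x : R => cos (th * x) - 1) /\
    Rintegral nu setT (fun x : R => sin (th * x)) =
      Rintegral nu' setT (fun x : R => sin (th * x)).
  apply: cexp_line_inj => t t0; rewrite -!cintegral_cexpB1.
  by rewrite -(levy_measure_exponent H)// (levy_measure_exponent H').
have I th := (cintegrable_cexpB1 nu _).1 (levy_measure_integrable H th).
have I' th := (cintegrable_cexpB1 nu' _).1 (levy_measure_integrable H' th).
have nuZ : nu (~` [set x : R | x \is a Num.int]) = 0%E.
  apply: carried_by_int; first exact: (I (pi *+ 2)).1.
  rewrite (E _).1 /Rintegral.
  rewrite (ae_eq_integral (cst 0%E))//; first by rewrite integral0.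
    by have /integrableP[] := (I' (pi *+ 2)).1.
  exists (~` [set x : R | x \is a Num.int]); split => //.
    by apply: measurableC; exact: measurable_int_set.
  by apply: subsetC => x /= xi _; rewrite cos2pi_int1// subrr.
split=> // k ki; have [->|k0] := eqVneq k 0.
  by rewrite (levy_measure_origin H) (levy_measure_origin H').
apply: lattice_measure_atoms => //.
- exact: levy_measure_finite_lattice H nuZ.
- exact: levy_measure_finite_lattice H' nuZ'.
- by move=> th; have [] := E th.
- by move=> th; have [] := E th.
Qed.

Lemma measurable_nat_set (R : realType) :
  measurable ([set x | exists k : nat, x = k%:R] : set (measurableTypeR R)).
Proof.
rewrite (_ : mkset _ = \bigcup_k [set k%:R : R]).
  by apply: bigcupT_measurable => k; exact: measurable_set1.
by apply/seteqP; split => x /= [k]; [move=> ->; exists k|move=> _ ->; exists k].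
Qed.

Lemma measurable_posnat_set (R : realType) :
  measurable ([set x | exists2 l : nat, (0 < l)%N & x = l%:R] : set (measurableTypeR R)).
Proof.
rewrite (_ : mkset _ = \bigcup_k [set k.+1%:R : R]).
  by apply: bigcupT_measurable => k; exact: measurable_set1.
apply/seteqP; split => x /=; last by move=> [k _ ->]; exists k.+1.
by move=> [[|k] // _ ->]; exists k.
Qed.

Lemma levy_measure_nat_unique (d : measure_display) (T : measurableType d)
    (R : realType) (P : probability T R) (X : R -> T -> R)
    (nu nu' : {measure set (measurableTypeR R) -> \bar R}) :
  levy_measure P X nu -> levy_measure P X nu' ->
  nu' (~` [set x | exists k : nat, x = k%:R]) = 0%E ->
  nu (~` [set x | exists2 l : nat, (0 < l)%N & x = l%:R]) = 0%E /\
  (forall k : nat, nu [set k%:R] = nu' [set k%:R]).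
Proof.
move=> H H' nuN'; pose Zc : set (measurableTypeR R) := ~` [set x : R | x \is a Num.int].
have mZc : measurable Zc by apply: measurableC; exact: measurable_int_set.
have mN := measurableC (@measurable_nat_set R).
have nuZ' : nu' Zc = 0%E.
  apply/eqP; rewrite -measure_le0 -nuN'; apply: le_measure; rewrite ?inE//.
  by apply: subsetC => x [k ->]; exact: natr_int.
have [nuZ nuk] := levy_measure_lattice_unique H H' nuZ'.
split; last by move=> k; apply: nuk; exact: natr_int.
pose neg (k : nat) : set (measurableTypeR R) := [set - k%:R].
have mneg k : measurable (neg k) by exact: measurable_set1.
have nuneg k : nu (neg k) = 0%E.
  have [->|k0] := eqVneq k 0%N; first by rewrite /neg oppr0; exact: levy_measure_origin H.
  rewrite /neg nuk ?rpredN ?natr_int//; apply/eqP; rewrite -measure_le0 -nuN'.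
  apply: le_measure; rewrite ?inE//.
  move=> x -> [j e]; have : (0 : R) <= - k%:R by rewrite e.
  by rewrite oppr_ge0 lern0 (negbTE k0).
have nU : nu.-negligible (Zc `|` \bigcup_k neg k).
  apply: negligibleU; first exact/negligibleP.
  apply: negligible_bigcup => k; exact: ((negligibleP nu (mneg k)).2 (nuneg k)).
apply: measure_negligible; first by apply: measurableC; exact: measurable_posnat_set.
apply: negligibleS nU => x /= xN.
have [xi|xi] := boolP ((x : R) \is a Num.int); last by left; exact/negP.
right; have /natrP[k xk] := natr_norm_int xi; exists k => //=.
have [x0|x0] := ltP 0 (x : R); last by rewrite /neg/= -xk ler0_norm ?opprK.
exfalso; apply: xN; exists k; last by rewrite -xk gtr0_norm.
by rewrite -(ltr_nat R) -xk gtr0_norm.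
Qed.

Lemma processes_time_change (d : measure_display) (T : measurableType d)
    (R : realType) (P : probability T R) (lambda alpha mu : R)
    (N D : R -> T -> R) (t : R) :
  0 < lambda -> poisson_process P lambda N ->
  tempered_stable_subordinator P alpha mu D -> independent_processes P N D ->
  0 <= t -> poisson_time_change P lambda N (D t).
Proof.
move=> l0 pN tD ind t0.
have LN := poisson_levy pN; have LD := tempered_levy tD.
split.
- exact: levy_measurable LD _ t0.
- by move=> w; rewrite -(levy_start LD w); exact: tempered_nondecreasing tD _ _ _ _ t0.
- by move=> s s0; exact: levy_measurable LN _ s0.
- by move=> w s s0; exact: (levy_cadlag LN w).1.
- by move=> s k s0; rewrite (poisson_marginal pN)// /poisson_pmf mulr_gt0.
- move=> s A B s0 mA mB.
  have := ind 1%N 1%N (fun=> s) (fun=> t) (fun=> A) (fun=> B)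
    (fun=> s0) (fun=> t0) (fun=> mA) (fun=> mB).
  have cap (E : set T) : \bigcap_(i in [set i : nat | (i < 1)%N]) E = E.
    by apply: bigcap_const; exists 0%N.
  by rewrite /= !cap.
Qed.

(** * The series representation *)

(** On the naturals p is a combination of the binomials C(x, j) with j > 0.  The
    partial sums are then eventually constant, equal to the same combination of
    factorial moments as the integral of p. *)
Lemma levy_series_poly (R : realType) (lambda alpha mu : R)
    (nu : {measure set (measurableTypeR R) -> \bar R}) (p : {poly R}) :
  0 < lambda -> 0 < alpha < 1 -> 0 < mu ->
  nu (~` [set x | exists k : nat, x = k%:R]) = 0%E ->
  (forall k : nat, nu [set k%:R] = (levy_mass lambda alpha mu k)%:E) ->
  p.[0] = 0 ->
  nu.-integrable setT (fun x : R => (p.[x])%:E) /\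
  (\sum_(1 <= n < M) levy_term lambda alpha mu n (horner p))
    @[M --> \oo] --> Rintegral nu setT (horner p).
Proof.
move=> l0 a01 m0 nuN nuc p0.
pose c := levy_mass lambda alpha mu.
have c0 k : 0 <= c k by exact: levy_mass_ge0.
have [a [d pE]] := poly_binomial_basis p.
pose b j := if j is 0%N then 0 else a j.
have {}pE l : p.[l%:R] = \sum_(0 <= j < d) b j * 'C(l, j)%:R.
  rewrite pE; apply: eq_big_nat => -[|j] /andP[_ jd] //=.
  have := pE 0%N; rewrite p0 big_ltn// bin0 mulr1 big1_seq ?addr0 => [<-|]; first by [].
  move=> i; rewrite mem_index_iota => /andP[_ /andP[i0 _]].
  by rewrite bin_small ?mulr0.
pose m j := (-1) ^+ j.+1 * levy_coef lambda alpha mu j.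
(* used for b, and for |b| as a majorant *)
have comb (e : nat -> R) : e 0%N = 0 ->
    series (fun l => c l * \sum_(0 <= j < d) e j * 'C(l, j)%:R) @ \oo -->
    \sum_(0 <= j < d) e j * m j.
  move=> e0; elim: d {pE} => [|k ih].
    rewrite big_nil; apply: cvg_near_cst; apply: nearW => n.
    by rewrite /series/= big1// => i _; rewrite big_nil mulr0.
  rewrite big_nat_recr//=.
  have hk : series (fun l => c l * (e k * 'C(l, k)%:R)) @ \oo --> e k * m k.
    case: k {ih} => [|k].
      rewrite e0 mul0r; apply: cvg_near_cst; apply: nearW => n.
      by rewrite /series/= big1// => i _; rewrite mul0r mulr0.
    apply: (cvgn_ext _ (cvg_series_scale (e k.+1) (@levy_mass_moment _ _ alpha _ k.+1 l0 m0 isT))) => n.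
    by congr series; apply/funext => l; rewrite mulrCA.
  have h : (fun n => series (fun l => c l * \sum_(0 <= j < k) e j * 'C(l, j)%:R) n +
    series (fun l => c l * (e k * 'C(l, k)%:R)) n) @ \oo -->
    \sum_(0 <= j < k) e j * m j + e k * m k by exact: cvgD.
  apply: (cvgn_ext _ h) => n; rewrite /series/= -big_split/=; apply: eq_bigr => l _.
  by rewrite big_nat_recr//= mulrDr.
have [ip sp] : nu.-integrable setT (EFin \o horner p) /\
    series (fun k => c k * p.[k%:R]) @ \oo --> Rintegral nu setT (horner p).
  apply: nat_carried_integral => //.
    exact: continuous_measurable_fun (@continuous_horner R p).
  have b0 : `|b 0%N| = 0 by rewrite normr0.
  apply: (series_le_cvg _ _ _ (cvgP _ (comb (fun j => `|b j|) b0))) => k.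
  - by rewrite mulr_ge0.
  - by rewrite mulr_ge0// sumr_ge0// => j _; rewrite mulr_ge0.
  - rewrite ler_wpM2l// pE; apply: le_trans (ler_norm_sum _ _ _) _.
    by apply: ler_sum => j _; rewrite normrM [`|'C(_, _)%:R|]ger0_norm.
split => //.
have -> : Rintegral nu setT (horner p) = \sum_(0 <= j < d) b j * m j.
  apply: (cvg_unique _ sp) => //.
  by apply: (cvgn_ext _ (comb b erefl)) => n; congr series; apply/funext => l; rewrite pE.
apply: cvg_near_cst; near=> M.
have dM : (d <= M)%N by near: M; exact: nbhs_infty_ge.
under eq_bigr do rewrite (levy_term_binomial _ _ _ _ pE)//.
rewrite exchange_big/=; apply: eq_big_nat => -[|j] /andP[_ jd].
  by rewrite mul0r big1// => i _; rewrite !mul0r.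
rewrite -mulr_sumr (bigD1_seq j.+1) ?mem_index_iota ?iota_uniq//=; last first.
  exact: leq_trans dM.
rewrite eqxx big1 ?addr0 ?mulr1// => i /negbTE ->.
by [].
Unshelve. all: end_near. Qed.

(** A bounded set contains finitely many atoms, so the statement reduces to the
    series [levy_mass_series] of each of them. *)
Lemma levy_series_set (R : realType) (lambda alpha mu : R)
    (nu : {measure set (measurableTypeR R) -> \bar R}) (A : set (measurableTypeR R)) :
  0 < lambda -> 0 < alpha < 1 -> lambda < mu ->
  nu (~` [set x | exists k : nat, x = k%:R]) = 0%E ->
  (forall k : nat, nu [set k%:R] = (levy_mass lambda alpha mu k)%:E) ->
  measurable A -> bounded_set (A : set R) ->
  (\sum_(1 <= n < M) levy_term lambda alpha mu n (\1_A))%:E @[M --> \oo] --> nu A.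
Proof.
move=> l0 a01 lm nuN nuc mA [K [_ Kb]].
have m0 : 0 < mu by exact: lt_trans lm.
pose c := levy_mass lambda alpha mu; pose f : R -> R := \1_A.
have c0 k : 0 <= c k by exact: levy_mass_ge0.
pose L := (Num.truncn (`|K| + 1)).+1.
have fL l : (L <= l)%N -> f l%:R = 0.
  move=> Ll; rewrite /f indicE memNset//= => Al.
  have : K < `|K| + 1 by rewrite (le_lt_trans (ler_norm K))// ltrDl.
  move=> /Kb /(_ _ Al) /=; rewrite ger0_norm// leNgt => /negP; apply.
  by apply: lt_le_trans (truncnS_gt _) _; rewrite ler_nat.
have [fi fs] : nu.-integrable setT (EFin \o f) /\
    series (fun k => c k * f k%:R) @ \oo --> Rintegral nu setT f.
  apply: nat_carried_integral => //.
    exact: (@measurable_indic _ (measurableTypeR R) R setT A mA).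
  apply: (series_le_cvg _ _ _ (cvgP _ (@cvg_levy_mass _ _ alpha _ l0 m0))) => k.
  - by rewrite mulr_ge0.
  - exact: c0.
  - by rewrite ler_piMr// /f indicE; case: (_ \in _); rewrite ?normr1 ?normr0.
have nuA : nu A = (\sum_(1 <= l < L) c l * f l%:R)%:E.
  have nuf : nu A \is a fin_num.
    have := integrable_fin_num measurableT fi.
    by rewrite (_ : \int[nu]_x _ = nu A)%E//= integral_indic// setIT.
  rewrite -[LHS]fineK// -Rintegral_indic//; congr EFin.
  apply: (cvg_unique _ fs) => //.
  apply: cvg_near_cst; near=> n.
  have Ln : (L <= n)%N by near: n; exact: nbhs_infty_ge.
  rewrite /series/= (big_cat_nat (n := L))//= [X in _ + X]big1_seq ?addr0.
    by rewrite big_ltn// mul0r add0r.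
  by move=> i; rewrite mem_index_iota => /andP[_ /andP[/fL -> _]]; rewrite mulr0.
rewrite nuA; apply: cvg_EFin; first exact: nearW.
have termE n : levy_term lambda alpha mu n f = \sum_(1 <= l < L)
    (-1) ^+ l.+1 * f l%:R * (levy_coef lambda alpha mu n * 'C(n, l)%:R).
  pose F l := (-1) ^+ l.+1 * f l%:R * (levy_coef lambda alpha mu n * 'C(n, l)%:R).
  rewrite /levy_term -/(levy_coef lambda alpha mu n) mulr_sumr.
  rewrite (eq_bigr F); last by move=> l _; rewrite /F; ring.
  have ext (a b : nat) : (0 < a <= b)%N -> (forall l, (a <= l)%N -> F l = 0) ->
      \sum_(1 <= l < a) F l = \sum_(1 <= l < b) F l.
    move=> /andP[a0 ab] Fa; rewrite [RHS](big_cat_nat (n := a))//=.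
    rewrite [X in _ + X]big1_seq ?addr0// => i.
    by rewrite mem_index_iota => /andP[_ /andP[/Fa]].
  rewrite (ext n.+1 (maxn n.+1 L)) ?leq_maxl//; last first.
    by move=> l nl; rewrite /F bin_small// !mulr0.
  rewrite -(ext L (maxn n.+1 L)) ?leq_maxr// => l Ll.
  by rewrite /F fL// mulr0 mul0r.
under eq_fun do rewrite (eq_bigr _ (fun n _ => termE n)) exchange_big/=.
have lim (k : nat) : (fun M => \sum_(1 <= l < k) \sum_(1 <= n < M)
    (-1) ^+ l.+1 * f l%:R * (levy_coef lambda alpha mu n * 'C(n, l)%:R)) @ \oo -->
    \sum_(1 <= l < k) c l * f l%:R.
  elim: k => [|[|k] ih].
  - by under eq_fun do rewrite big_geq//; rewrite big_geq//; exact: cvg_cst.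
  - by under eq_fun do rewrite big_geq//; rewrite big_geq//; exact: cvg_cst.
  under eq_fun do rewrite big_nat_recr//; rewrite [\sum_(1 <= l < k.+2) c l * _]big_nat_recr//.
  apply: cvgD => //.
  pose s : R := (-1) ^+ k.+2.
  have e : c k.+1 * f k.+1%:R = s * f k.+1%:R * (s * c k.+1).
    have ss : s * s = 1 by rewrite -expr2 sqrr_sign.
    by rewrite -[LHS]mul1r -ss; ring.
  have h := cvg_series_scale (s * f k.+1%:R) (@levy_mass_series _ _ alpha _ k.+1 l0 lm isT).
  rewrite e -cvg_shiftS; rewrite -cvg_shiftS in h.
  apply: (cvgn_ext _ h) => M.
  by rewrite /series/= big_ltn// bin0n !mulr0 add0r.
exact: lim.
Unshelve. all: end_near. Qed.

Theorem proposition2p2 (R : realType) (d : measure_display)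
  (T : measurableType d) (P : probability T R) (lambda alpha mu : R)
  (N D : R -> T -> R)
  (lambda_gt0 : 0 < lambda) (alpha_gt0 : 0 < alpha) (alpha_lt1 : alpha < 1)
  (mu_gt0 : 0 < mu)
  (poissonN : poisson_process P lambda N)
  (temperedD : tempered_stable_subordinator P alpha mu D)
  (indepND : independent_processes P N D) :
  (exists nu : {measure set (measurableTypeR R) -> \bar R},
     levy_measure P (subordinated N D) nu) /\
  (forall nu : {measure set (measurableTypeR R) -> \bar R},
     levy_measure P (subordinated N D) nu ->
     [/\ nu (~` [set x | exists2 l : nat, (0 < l)%N & x = l%:R]) = 0%E,
         forall p : {poly R}, p.[0] = 0 ->
           nu.-integrable setT (fun x : R => (p.[x])%:E) /\
           (\sum_(1 <= n < M) levy_term lambda alpha mu n (horner p))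
             @[M --> \oo] --> Rintegral nu setT (horner p)
       & lambda < mu ->
         forall A : set (measurableTypeR R), measurable A ->
           bounded_set (A : set R) ->
           (\sum_(1 <= n < M) levy_term lambda alpha mu n (\1_A))%:E
             @[M --> \oo] --> nu A]).
Proof.
have a01 : 0 < alpha < 1 by rewrite alpha_gt0.
have ptc t (t0 : 0 <= t) := processes_time_change lambda_gt0 poissonN temperedD indepND t0.
have lap s t : 0 < s -> 0 <= t -> Rintegral P setT (fun w => expR (- s * D t w)) =
    expR (- t * ((s + mu) `^ alpha - mu `^ alpha)).
  move=> s0 t0; have := tempered_laplace temperedD s0 t0.
  by rewrite unlock /Rintegral => ->.
have [nu0 [nu0N nu0c]] := atomic_measure_exists
  (fun l => levy_mass_ge0 l lambda_gt0 a01 mu_gt0).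
have H0 := levy_measure_of_masses lambda_gt0 a01 mu_gt0 ptc lap nu0N nu0c.
split; first by exists nu0.
move=> nu H.
have [nuN nuk] := levy_measure_nat_unique H H0 nu0N.
have nuc k : nu [set k%:R] = (levy_mass lambda alpha mu k)%:E.
  by rewrite nuk nu0c.
have nuN0 : nu (~` [set x | exists k : nat, x = k%:R]) = 0%E.
  apply/eqP; rewrite -measure_le0 -nuN; apply: le_measure; rewrite ?inE.
  - by apply: measurableC; exact: measurable_nat_set.
  - by apply: measurableC; exact: measurable_posnat_set.
  - by apply: subsetC => x [l _ ->]; exists l.
split => //.
- by move=> p p0; exact: levy_series_poly.
- by move=> lm A mA bA; exact: levy_series_set.
Qed.
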